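(* For every real $k$ with $|k|\ge 16/(3\sqrt3)$, we have $\mathrm{m}(P_k)=\mathrm{m}(R_k)$, where $$P_k(x,y)=(x^2+x+1)y^2+kx(x+1)y+x(x^2+x+1)\qquad\text{and}\qquad R_k(x,y)=y^3-y+x^3-x+kxy.$$
   Context: For a nonzero Laurent polynomial $F(x,y)\in\mathbb C[x^{\pm1},y^{\pm1}]$, its (logarithmic) Mahler measure is $$\mathrm{m}(F)=\frac1{(2\pi i)^2}\iint_{|x|=|y|=1}\log|F(x,y)|\,\frac{dx}{x}\,\frac{dy}{y}.$$ *)

(* Defs.v *)
From HB Require Import structures.
From mathcomp Require Import all_boot all_order all_algebra.
From mathcomp Require Import all_classical all_reals all_analysis.
From mathcomp Require Import complex.
Set Implicit Arguments. Unset Strict Implicit. Unset Printing Implicit Defensive.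
Import Order.TTheory GRing.Theory Num.Theory.
Local Open Scope classical_set_scope.
Local Open Scope ring_scope.

Definition circ (R : realType) (t : R) : R[i] := Complex (cos t) (sin t).

Definition mahler (R : realType) (F : R[i] -> R[i] -> R[i]) : \bar R :=
  (((2 * pi) ^+ 2)^-1)%:E *
  (\int[(@lebesgue_measure R \x @lebesgue_measure R)%E]_(z in
       `[0%R, (2 * pi)%R]%classic `*` `[0%R, (2 * pi)%R]%classic)
     (ln (Normc.normc (F (circ z.1) (circ z.2))))%:E)%E.

Definition P_k (R : realType) (k : R) (x y : R[i]) : R[i] :=
  (x ^+ 2 + x + 1) * y ^+ 2 + (k%:C)%C * x * (x + 1) * y + x * (x ^+ 2 + x + 1).

Definition R_k (R : realType) (k : R) (x y : R[i]) : R[i] :=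
  y ^+ 3 - y + x ^+ 3 - x + (k%:C)%C * x * y.

(* Main.v *)
Require Import Defs.
From HB Require Import structures.
From mathcomp Require Import all_boot all_order all_algebra.
From mathcomp Require Import all_classical all_reals all_analysis.
From mathcomp Require Import complex.
From mathcomp Require Import measurable_realfun ring lra.
Import Order.TTheory GRing.Theory Num.Theory.
Import numFieldNormedType.Exports.
Local Open Scope classical_set_scope.
Local Open Scope ring_scope.

(* Put K = |k|. Shearing the torus turns P_k into a polynomial that factors for
   each fixed angle psi, and R_k into one that factors for each fixed angle t,
   all roots being real or on the unit circle; Jensen's formula then gives
     m(P_k) = mean of ln X_P over v = 4 (sin psi)^2,
     m(R_k) = mean of ln X_R over w = 2 + 2 cos t,
   with X_P = (S + sqrt (S^2 - 4 v)) / 2, S = (K + sqrt (K^2 + 4 v)) / 2 and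
   X_R = (K + sqrt (K^2 + 4 w (w - 3))) / 2. For R_k this uses that one
   root lies in the closed unit disc and the other outside the open one, which
   is where the bound on |k| enters: 256 / 27 is the maximum of w (4 - w)^2 on
   [0, 4].
   The two means agree for every K > 3. Their K-derivatives are periods of
   2-isogenous elliptic curves, and a Landen substitution psi = psi(t) carries
   one integrand to the other; moreover X_P and X_R are both K + O(1), so the
   difference of the means, being constant, is 0. *)

(** * Logarithmic means over the circle *)

Section Circle.
Set Implicit Arguments.
Unset Strict Implicit.
Context {R : realType}.
Notation mu := (@lebesgue_measure R).
Notation I2pi := (`[0%R, (2 * pi)%R]%classic : set R).

(** The number 3 is where both radicals degenerate: as K decreases, the inner radicand of [XP] first
    vanishes at K = 3, v = 4, and that of [XR] at K = 3, w = 3 / 2. Since 16 / (3 sqrt 3) exceeds 3,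
    the calculus in K can be done on the open half-line K > 3, where both K-derivatives are bounded
    locally uniformly in the angle. The obstacle on the torus is zeros on the torus itself. For each
    psi, one factor of the sheared P_k has its roots on the unit circle, and at the extreme value of
    |k| a root of R_k reaches it when w = 4 / 3. Jensen's formula is therefore needed for 1 - r z
    with |r| = 1 as well, and the logarithms are bounded above but not below, so iterated integrals
    are exchanged only after subtraction from an upper bound. *)

Lemma lebesgue_measure_shift (c : R) (A : set R) : measurable A ->
  pushforward mu ((fun x => x + c) : _ -> measurableTypeR R) A = mu A.
Proof.
have mc : measurable_fun setT ((fun x => x + c) : R -> measurableTypeR R).
  by apply: measurable_funD.
move=> mA; apply/esym/lebesgue_measure_unique => //= _ [[a b]] _ <-.
rewrite /pushforward/=.
have -> : (fun x : R => x + c) @^-1` `]a, b] = `](a - c), (b - c)]%classic.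
  by apply/seteqP; split => x /=; rewrite !in_itv/= lerBrDr ltrBlDr.
rewrite !lebesgue_measure_itv/= !lte_fin ltrBlDr subrK.
by case: ifP => // _; rewrite -!EFinD; congr EFin; lra.
Qed.

Lemma ge0_integral_shift (c a b : R) (f : R -> \bar R) :
  measurable_fun setT f -> (forall x, (0 <= f x)%E) ->
  (\int[mu]_(x in `[a, b[) f (x + c)%R = \int[mu]_(x in `[(a + c)%R, (b + c)%R[) f x)%E.
Proof.
move=> mf f0.
have mc : measurable_fun setT ((fun x => x + c) : R -> measurableTypeR R).
  by apply: measurable_funD.
transitivity (\int[pushforward mu ((fun x => x + c)%R : _ -> measurableTypeR R)]_(x in
    `[(a + c)%R, (b + c)%R[) f x)%E; last first.
  by apply: eq_measure_integral => //= A mA AS; exact: lebesgue_measure_shift.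
rewrite ge0_integral_pushforward//=; last exact: measurable_funTS.
have -> // : (fun x : R => x + c) @^-1` `[(a + c)%R, (b + c)%R[ = `[a, b[%classic.
by apply/seteqP; split => x /=; rewrite !in_itv/= lerD2r ltrD2r.
Qed.

Lemma lebesgue_measure_reflect (c : R) (A : set R) : measurable A ->
  pushforward mu ((fun x => c - x) : _ -> measurableTypeR R) A = mu A.
Proof.
have mc : measurable_fun setT ((fun x => c - x) : R -> measurableTypeR R).
  by apply: measurable_funB.
move=> mA; apply/esym/lebesgue_measure_unique => //= _ [[a b]] _ <-.
rewrite /pushforward/=.
have -> : (fun x : R => c - x) @^-1` `]a, b] = `[(c - b), (c - a)[%classic.
  apply/seteqP; split => x /=; rewrite !in_itv/=; lra.
rewrite !lebesgue_measure_itv/= !lte_fin.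
have -> : (c - b < c - a) = (a < b) by lra.
by case: ifP => // _; rewrite -!EFinD; congr EFin; lra.
Qed.

Lemma ge0_integral_reflect (c a b : R) (f : R -> \bar R) :
  measurable_fun setT f -> (forall x, (0 <= f x)%E) ->
  (\int[mu]_(x in `[a, b]) f (c - x)%R = \int[mu]_(x in `[(c - b)%R, (c - a)%R]) f x)%E.
Proof.
move=> mf f0.
have mc : measurable_fun setT ((fun x => c - x) : R -> measurableTypeR R).
  by apply: measurable_funB.
transitivity (\int[pushforward mu ((fun x => c - x)%R : _ -> measurableTypeR R)]_(x in
    `[(c - b)%R, (c - a)%R]) f x)%E; last first.
  by apply: eq_measure_integral => //= A mA AS; exact: lebesgue_measure_reflect.
rewrite ge0_integral_pushforward//=; last exact: measurable_funTS.
have -> // : (fun x : R => c - x) @^-1` `[(c - b)%R, (c - a)%R] = `[a, b]%classic.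
by apply/seteqP; split => x /=; rewrite !in_itv/=; lra.
Qed.

Lemma periodicz (T : Type) (f : R -> T) (p : R) (z : int) (x : R) :
  (forall x, f (x + p) = f x) -> f (x + p *~ z) = f x.
Proof.
move=> fp; have fn (n : nat) y : f (y + p *+ n) = f y.
  by elim: n => [|n IH]; rewrite ?mulr0n ?addr0// mulrSr addrA fp.
case: z => n; first exact: fn.
by rewrite NegzE mulrNz -[in RHS](subrK (p *~ n.+1) x) -pmulrn fn.
Qed.

Lemma ge0_integral_periodic (c : R) (f : R -> \bar R) :
  measurable_fun setT f -> (forall x, (0 <= f x)%E) ->
  (forall x, f (x + 2 * pi)%R = f x) ->
  (\int[mu]_(x in I2pi) f (x + c)%R = \int[mu]_(x in I2pi) f x)%E.
Proof.
move=> mf f0 fp.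
have pi0 : 0 < 2 * pi :> R by rewrite mulr_gt0// pi_gt0.
set p := 2 * pi in pi0 fp *.
have msh (d : R) : measurable_fun setT (fun x : R => f (x + d)).
  by apply: measurableT_comp => //; apply: measurable_funD.
wlog : c / 0 <= c < p.
  move=> H; pose z := Num.floor (c / p).
  have -> : (\int[mu]_(x in `[0%R, p]) f (x + c)%R = \int[mu]_(x in `[0%R, p]) f (x + (c - p *~ z))%R)%E.
    by apply: eq_integral => x _; rewrite -[RHS](periodicz z _ fp); congr f; lra.
  apply: H.
  have /andP[zl zu] := floor_itv (c / p).
  move: zl zu; rewrite -/z ler_pdivlMr// ltr_pdivrMr// intrD mulrDl mul1r.
  by rewrite -mulrzl; lra.
move=> /andP[c0 cp].
(* Half-open intervals concatenate without overlap: [[c, p + c[] is cut at [p], and its second piece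
   is [[0, c[] moved by one period. *)
rewrite -!integral_itv_bndo_bndc; last 2 first.
- exact: measurable_funTS.
- exact: measurable_funTS (msh c).
rewrite ge0_integral_shift// add0r.
have e1 : `[c, (p + c)[%classic = `[c, p[%classic `|` `[p, (p + c)[%classic.
  by rewrite -itv_bndbnd_setU// bnd_simp; lra.
have e2 : `[0%R, p[%classic = `[0%R, c[%classic `|` `[c, p[%classic.
  by rewrite -itv_bndbnd_setU// bnd_simp; lra.
rewrite e1 e2 !ge0_integral_setU//; try exact: measurable_funTS; last 2 first.
- apply/disj_setPLR => x /=; rewrite !in_itv/=; lra.
- apply/disj_setPLR => x /=; rewrite !in_itv/=; lra.
rewrite addeC; congr (_ + _)%E.
rewrite -[X in `[X, _[%classic]add0r [p + c]addrC -ge0_integral_shift//.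
by apply: eq_integral => x _.
Qed.


Lemma integral_periodic (c : R) (f : R -> \bar R) :
  measurable_fun setT f -> (forall x, f (x + 2 * pi)%R = f x) ->
  (\int[mu]_(x in I2pi) f (x + c)%R = \int[mu]_(x in I2pi) f x)%E.
Proof.
move=> mf fp; rewrite integralE [RHS]integralE; congr (_ - _)%E.
- transitivity (\int[mu]_(x in I2pi) (f^\+ (x + c)%R))%E.
    by apply: eq_integral => x _; rewrite ?funeposE ?funenegE.
  apply: ge0_integral_periodic => //.
  + exact: measurable_funepos.
  + by move=> x; rewrite !funeposE fp.
- transitivity (\int[mu]_(x in I2pi) (f^\- (x + c)%R))%E.
    by apply: eq_integral => x _; rewrite ?funeposE ?funenegE.
  apply: ge0_integral_periodic => //.
  + exact: measurable_funeneg.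
  + by move=> x; rewrite !funenegE fp.
Qed.

Lemma integral_reflect (f : R -> \bar R) : measurable_fun setT f ->
  (\int[mu]_(x in I2pi) f (2 * pi - x)%R = \int[mu]_(x in I2pi) f x)%E.
Proof.
have e g := @ge0_integral_reflect (2 * pi) 0 (2 * pi) g; rewrite subrr subr0 in e.
move=> mf; rewrite integralE [RHS]integralE; congr (_ - _)%E.
- transitivity (\int[mu]_(x in I2pi) (f^\+ (2 * pi - x)%R))%E.
    by apply: eq_integral => x _; rewrite ?funeposE ?funenegE.
  by apply: e => //; exact: measurable_funepos.
- transitivity (\int[mu]_(x in I2pi) (f^\- (2 * pi - x)%R))%E.
    by apply: eq_integral => x _; rewrite ?funeposE ?funenegE.
  by apply: e => //; exact: measurable_funeneg.
Qed.

(* Since ln 0 = 0, ln is additive on products only off their zeros, which are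
   therefore required to be negligible. *)
Definition mean_log (f : R -> R) (I : R) : Prop :=
  [/\ measurable_fun setT f, (forall x, 0 <= f x),
      mu (I2pi `&` f @^-1` [set 0]) = 0%E,
      mu.-integrable I2pi (EFin \o (@ln R \o f)) &
      (\int[mu]_(x in I2pi) (ln (f x))%:E = I%:E)%E].

Lemma mean_logM f g I J :
  mean_log f I -> mean_log g J -> mean_log (f \* g) (I + J).
Proof.
move=> [mf f0 zf If If'] [mg g0 zg Ig Ig'].
have mz (h : R -> R) : measurable_fun setT h -> measurable (I2pi `&` h @^-1` [set 0]).
  by move=> mh; apply: measurableI => //; rewrite -[X in measurable X]setTI; exact: mh.
have mfg : measurable_fun setT (f \* g) by exact: measurable_funM.
pose N : set (measurableTypeR R) := I2pi `&` (f \* g) @^-1` [set 0].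
have mN : measurable N by exact: mz.
have N0 : mu N = 0%E.
  apply: (@subset_measure0 _ _ _ mu _ ((I2pi `&` f @^-1` [set 0]) `|` (I2pi `&` g @^-1` [set 0]))) => //.
  - by apply: measurableU; exact: mz.
  - move=> x [Ix /= /eqP]; rewrite mulf_eq0 => /orP[]/eqP fx; [left|right]; by split.
  - by apply: null_set_setU => //; exact: mz.
have eqN : {in I2pi `\` N, (EFin \o (@ln R \o (f \* g))) =1 (fun x => (ln (f x))%:E + (ln (g x))%:E)%E}.
  move=> x /[!inE] -[Ix nx]; rewrite /= -EFinD lnM// posrE lt_neqAle ?f0 ?g0 andbT eq_sym;
    by apply: contra_notN nx => /eqP fx; split => //=; rewrite fx ?mul0r ?mulr0.
have iD : mu.-integrable I2pi (fun x => (ln (f x))%:E + (ln (g x))%:E)%E by exact: integrableD.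
have mD : measurable (I2pi `\` N) by exact: measurableD.
have ifg : mu.-integrable I2pi (EFin \o (@ln R \o (f \* g))).
  have mh : measurable_fun I2pi (EFin \o (@ln R \o (f \* g))).
    by apply/measurable_EFinP; apply: measurable_funTS; apply: measurableT_comp => //; exact: measurable_ln.
  rewrite (negligible_integrable mN)//.
  apply: eq_integrable (integrableS _ _ _ iD) => //.
  by move=> x xN; rewrite eqN.
split => //.
- by move=> x; rewrite mulr_ge0.
- rewrite -[LHS]/(integral mu I2pi (EFin \o (@ln R \o (f \* g)))) (negligible_integral mN)//.
  transitivity (\int[mu]_(x in I2pi `\` N) ((ln (f x))%:E + (ln (g x))%:E))%E.
    by apply: eq_integral => x xN; exact: eqN.
  by rewrite -negligible_integral// integralD// EFinD -If' -Ig'.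
Qed.

Lemma mean_log_shift f I c : (forall x, f (x + 2 * pi) = f x) ->
  mean_log f I -> mean_log (fun x => f (x + c)) I.
Proof.
move=> fp [mf f0 zf If If'].
have mc : measurable_fun setT (fun x : R => x + c) by apply: measurable_funD.
have mfc : measurable_fun setT (fun x : R => f (x + c)) by exact: measurableT_comp mf mc.
have ml : measurable_fun setT (EFin \o (@ln R \o f)).
  by apply/measurable_EFinP; apply: measurableT_comp => //; exact: measurable_ln.
have zm : measurable (f @^-1` [set 0]) by rewrite -[X in measurable X]setTI; exact: mf.
have zmc : measurable ((fun x => f (x + c)) @^-1` [set 0]).
  by rewrite -[X in measurable X]setTI; exact: mfc.
split => //.
(* The zero set is translated by writing its measure as the integral of an indicator, which is
   periodic because [f] is. *)
- rewrite setIC -integral_indic//; rewrite setIC -integral_indic// in zf.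
  rewrite -[RHS]zf -(ge0_integral_periodic c (f := fun x => (\1_(f @^-1` [set 0]) x)%:E))//.
  + by apply/measurable_EFinP; exact: measurable_indic.
  + by move=> x; congr (_%:E); rewrite !indicE; congr (_%:R); congr (nat_of_bool _); apply/idP/idP; rewrite !inE/= fp.
- apply/integrableP; split.
    apply/measurable_EFinP; apply: measurable_funTS.
    by apply: measurableT_comp => //; exact: measurable_ln.
  rewrite (ge0_integral_periodic c (f := fun x => `|(ln (f x))%:E|%E))//.
  + by case/integrableP : If.
  + by apply: measurableT_comp ml.
  + by move=> x; rewrite fp.
- by rewrite (integral_periodic c (f := fun x => (ln (f x))%:E))// => x; rewrite fp.
Qed.

Lemma mu_I2pi : mu I2pi = (2 * pi)%:E.
Proof.
by rewrite lebesgue_measure_itv/= lte_fin mulr_gt0 ?pi_gt0// -EFinD subr0.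
Qed.

Lemma mu_I2pi_fin : (mu I2pi < +oo)%E.
Proof. by rewrite mu_I2pi ltry. Qed.

Lemma mean_log_bounded (f : R -> R) m M :
  measurable_fun setT f -> 0 < m -> (forall x, m <= f x <= M) ->
  exists2 I, mean_log f I & 2 * pi * ln m <= I <= 2 * pi * ln M.
Proof.
move=> mf m0 fb.
have fp x : 0 < f x by have /andP[+ _] := fb x; exact: lt_le_trans.
have M0 : 0 < M by have /andP[+ /(lt_le_trans _)] := fb 0 => ? ->.
have lb x : ln m <= ln (f x) <= ln M.
  by have /andP[h1 h2] := fb x; rewrite !ler_ln ?posrE// h1 h2.
have ml : measurable_fun I2pi (@ln R \o f).
  by apply: measurable_funTS; apply: measurableT_comp => //; exact: measurable_ln.
have il : mu.-integrable I2pi (EFin \o (@ln R \o f)).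
  apply: measurable_bounded_integrable => //; first exact: mu_I2pi_fin.
  exists (`|ln m| + `|ln M|); split; first by rewrite num_real.
  move=> y yM x _ /=; apply: le_trans (ltW yM).
  have := lb x; have := ler_norm (ln M); have := ler_norm (- ln m); rewrite normrN.
  by move=> h1 h2 h3; rewrite ler_norml; have := normr_ge0 (ln M); have := normr_ge0 (ln m); lra.
exists (\int[mu]_(x in I2pi) (ln (f x))).
  split => //; first by move=> x; exact: ltW.
  - rewrite (_ : _ `&` _ = set0)// -subset0 => x [_ /= fx0].
    by have := fp x; rewrite fx0 ltxx.
  - by rewrite /Rintegral fineK//; exact: integrable_fin_num.
have ic (c : R) : mu.-integrable I2pi (EFin \o cst c).
  apply: measurable_bounded_integrable => //; first exact: mu_I2pi_fin.
  by exists `|c|; split; rewrite ?num_real// => y cy x _ /=; exact: ltW.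
have e (c : R) : 2 * pi * c = \int[mu]_(x in I2pi) c.
  by rewrite Rintegral_cst//= mulrC; congr (_ * _); apply/esym; exact: (congr1 fine mu_I2pi).
rewrite !e; apply/andP; split; apply: le_Rintegral => //; try exact: ic.
- by move=> x _; have /andP[] := lb x.
- by move=> x _; have /andP[] := lb x.
Qed.


Lemma eq_mean_log (f g : R -> R) I : f =1 g -> mean_log f I -> mean_log g I.
Proof. by move=> /funext ->. Qed.

Lemma mean_log_unique f I J : mean_log f I -> mean_log f J -> I = J.
Proof. by move=> [_ _ _ _ e] [_ _ _ _]; rewrite e => -[]. Qed.

Lemma mean_log_cst c : 0 < c -> mean_log (cst c) (2 * pi * ln c).
Proof.
move=> c0; have [I h Ic] := @mean_log_bounded (cst c) c c (measurable_cst _) c0 (fun=> (ltac:(by rewrite /= lexx))).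
by have -> : 2 * pi * ln c = I by apply/eqP; rewrite eq_le.
Qed.

Lemma measurable_cos : measurable_fun setT (@cos R).
Proof. by apply: continuous_measurable_fun; exact: continuous_cos. Qed.

(* |1 - r e^(it)|^2 *)
Definition circ2 (r t : R) := 1 - 2 * r * cos t + r ^+ 2.

Lemma cos_periodic (t : R) : cos (t + 2 * pi) = cos t.
Proof. by rewrite mulrC mulr_natr cosD2pi. Qed.

Lemma circ2_bounds r t : 0 <= r -> r <= 1 -> (1 - r) ^+ 2 <= circ2 r t <= 4.
Proof.
move=> r0 r1; rewrite /circ2.
have c1 := cos_le1 t; have c2 := cos_geN1 t.
have h1 : 0 <= r * (1 - cos t) by rewrite mulr_ge0// subr_ge0.
have h2 : 0 <= r * (1 + cos t) by rewrite mulr_ge0//; lra.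
nra.
Qed.

Lemma measurable_circ2 r : measurable_fun setT (circ2 r).
Proof.
rewrite /circ2; apply: measurable_funD => //; apply: measurable_funB => //.
by apply: measurable_funM => //; exact: measurable_cos.
Qed.

Lemma circ2_double r n t :
  circ2 r (2 ^+ n * t) * circ2 r (2 ^+ n * (t + pi / 2 ^+ n)) = circ2 (r ^+ 2) (2 ^+ n.+1 * t).
Proof.
have -> : 2 ^+ n * (t + pi / 2 ^+ n) = 2 ^+ n * t + pi :> R.
  by rewrite mulrDr mulrCA divff ?mulr1// expf_neq0.
have -> : 2 ^+ n.+1 * t = (2 ^+ n * t) *+ 2 by rewrite exprS -mulr_natr; lra.
rewrite /circ2 cosDpi cos_mulr2n; lra.
Qed.

(* |1 - z^2| = |1 - z| |1 + z|: the mean at r^(2^n) is 2^n times the mean at r,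
   while it stays bounded when r < 1. *)
Lemma mean_log_circ2_iter r I n : mean_log (circ2 r) I ->
  mean_log (fun t => circ2 (r ^+ (2 ^ n)) (2 ^+ n * t)) (2 ^+ n * I).
Proof.
move=> rI; elim: n => [|n IH].
  by rewrite expr1 mul1r; apply: eq_mean_log rI => t; rewrite mul1r.
have per t : circ2 (r ^+ (2 ^ n)) (2 ^+ n * (t + 2 * pi)) = circ2 (r ^+ (2 ^ n)) (2 ^+ n * t).
  rewrite /circ2; congr (_ - _ * _ + _); rewrite mulrDr.
  have -> : 2 ^+ n * (2 * pi) = (2 * pi) *~ ((2 ^ n)%N : int) :> R.
    by rewrite -mulrzr -pmulrn natrX mulrC.
  exact: periodicz cos_periodic.
have := mean_logM IH (mean_log_shift (pi / 2 ^+ n) per IH).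
have -> : 2 ^+ n * I + 2 ^+ n * I = 2 ^+ n.+1 * I by rewrite exprS; lra.
by apply: eq_mean_log => t /=; rewrite circ2_double -exprM -expnSr.
Qed.

Lemma mean_log_circ2_lt1 r : 0 <= r -> r < 1 -> mean_log (circ2 r) 0.
Proof.
move=> r0 r1.
have p0 : 0 < (1 - r) ^+ 2 by rewrite exprn_gt0// subr_gt0.
have [I rI _] := mean_log_bounded (measurable_circ2 r) p0 (fun t => circ2_bounds t r0 (ltW r1)).
suff I0 : I = 0 by rewrite -[X in mean_log _ X]I0.
pose C := 2 * pi * (`|ln ((1 - r) ^+ 2)| + `|ln 4|).
(* Since [r ^+ (2 ^ n) <= r], the bounds [(1 - r) ^+ 2] and 4 hold for every iterate, so
   [2 ^+ n * I] stays bounded and [I] must vanish. *)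
have bd n : `|2 ^+ n * I| <= C.
  have rI' := mean_log_circ2_iter n rI; set q := r ^+ (2 ^ n) in rI'.
  have q0 : 0 <= q by rewrite exprn_ge0.
  have qr : q <= r.
    by rewrite /q -[leRHS]expr1 ler_wiXn2l// ?expn_gt0// ltW.
  have [||t|J qJ] := @mean_log_bounded (fun t => circ2 q (2 ^+ n * t)) ((1 - r) ^+ 2) 4.
  - by apply: measurableT_comp (measurable_circ2 q) _; exact: measurable_funM.
  - by [].
  - have /andP[h1 ->] := circ2_bounds (2 ^+ n * t) q0 (le_trans qr (ltW r1)).
    by rewrite andbT; apply: le_trans h1; rewrite ler_sqr ?nnegrE; lra.
  rewrite (mean_log_unique rI' qJ) /C => /andP[h1 h2].
  have pi0 := pi_gt0 R.
  have a1 : 0 <= pi * (ln ((1 - r) ^+ 2) + `|ln ((1 - r) ^+ 2)|).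
    by rewrite mulr_ge0 ?pi_ge0// addrC -lerBlDr sub0r -normrN ler_norm.
  have a2 : 0 <= pi * (`|ln 4| - ln 4) :> R by rewrite mulr_ge0 ?pi_ge0// subr_ge0 ler_norm.
  have a3 : 0 <= pi * `|ln 4| :> R by rewrite mulr_ge0 ?pi_ge0.
  have a4 : 0 <= pi * `|ln ((1 - r) ^+ 2)| :> R by rewrite mulr_ge0 ?pi_ge0.
  by rewrite ler_norml; apply/andP; split; lra.
apply: contrapT => /eqP I0.
have In : 0 < `|I| by rewrite normr_gt0.
have C0 : 0 <= C / `|I| by rewrite divr_ge0//; exact: le_trans (normr_ge0 _) (bd 0%N).
have := archi_boundP C0; set n := Num.bound _ => hn.
have := bd n; rewrite normrM ger0_norm ?exprn_ge0// -ler_pdivlMr// leNgt => /negP; apply.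
by apply: lt_trans hn _; rewrite -natrX ltr_nat ltn_expl.
Qed.

Lemma cos_lt1 (t : R) : 0 < t < 2 * pi -> cos t < 1.
Proof.
move=> /andP[t0 t2].
have -> : t = (t / 2) *+ 2 by rewrite -mulr_natr; lra.
rewrite cos_mulr2n.
have s : 0 < sin (t / 2) by apply: sin_gt0_pi; lra.
have := cos2Dsin2 (t / 2); nra.
Qed.


(* The limit r -> 1: Fatou's lemma shows that ln |1 - e^(it)| is integrable, and
   |1 - e^(it)| <= 2 |1 - r e^(it)| then allows dominated convergence. *)
Lemma mean_log_circ2_1 : mean_log (circ2 1) 0.
Proof.
(* The endpoints are dropped because [circ2 1] vanishes there, and [ln] is continuous only at
   positive points. *)
pose D : set (measurableTypeR R) := `]0%R, (2 * pi)%R[%classic.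
have mD : measurable D by exact: measurable_itv.
pose r_ (n : nat) : R := 1 - harmonic n.
have r0 n : 0 <= r_ n by rewrite /r_ /= subr_ge0 invf_le1// ler1n.
have r1 n : r_ n < 1 by rewrite /r_ /= gtrBl invr_gt0.
have r1' n := ltW (r1 n).
have rcvg : r_ @ \oo --> (1 : R).
  rewrite -[X in _ --> X]subr0; apply: cvgB; [exact: cvg_cst|exact: cvg_harmonic].
have f1pos x : D x -> 0 < circ2 1 x.
  by rewrite /D/= in_itv/= => /cos_lt1; rewrite /circ2; lra.
have fpos n x : 0 < circ2 (r_ n) x.
  have /andP[h _] := circ2_bounds x (r0 n) (r1' n); apply: lt_le_trans h.
  by rewrite exprn_gt0// subr_gt0.
have fle n x : circ2 (r_ n) x <= 4 by have /andP[] := circ2_bounds x (r0 n) (r1' n).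
have f1le x : circ2 1 x <= 4 by have /andP[] := circ2_bounds x ler01 (lexx 1).
have fcvg x : D x -> ln (circ2 (r_ n) x) @[n --> \oo] --> ln (circ2 1 x).
  move=> Dx; apply: (@continuous_cvg _ _ _ _ _ _ (@ln R)).
    by apply: continuous_ln; exact: f1pos.
  apply: cvgD; last by rewrite expr2; apply: cvgM.
  apply: cvgB; first exact: cvg_cst.
  by apply: cvgMr_tmp; apply: cvgMl_tmp.
have mln n : measurable_fun D (fun x => (ln (circ2 (r_ n) x))%:E).
  apply/measurable_EFinP; apply: measurable_funTS.
  by apply: measurableT_comp (measurable_circ2 _) => //; exact: measurable_ln.
have ml1 : measurable_fun D (fun x => (ln (circ2 1 x))%:E).
  apply/measurable_EFinP; apply: measurable_funTS.
  by apply: measurableT_comp (measurable_circ2 _) => //; exact: measurable_ln.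
have oc (h : R -> \bar R) : measurable_fun D h ->
    (\int[mu]_(x in D) h x = \int[mu]_(x in I2pi) h x)%E.
  by move=> mh; apply/esym/integral_itv_bndoo.
have int0 n : (\int[mu]_(x in D) (ln (circ2 (r_ n) x))%:E = 0)%E.
  by rewrite oc//; have [_ _ _ _] := mean_log_circ2_lt1 (r0 n) (r1 n).
have intn n : mu.-integrable D (fun x => (ln (circ2 (r_ n) x))%:E).
  have [_ _ _ + _] := mean_log_circ2_lt1 (r0 n) (r1 n).
  by apply: integrableS => //; exact: subset_itv_oo_cc.
have muD : mu D = (2 * pi)%:E.
  by rewrite /D lebesgue_measure_itv/= lte_fin mulr_gt0 ?pi_gt0// -EFinD subr0.
have ic (c : R) : mu.-integrable D (fun=> c%:E).
  apply: (measurable_bounded_integrable (f := cst c)) => //; first by rewrite [X in (X < _)%E]muD ltry.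
  by exists `|c|; split; rewrite ?num_real// => y cy x _ /=; exact: ltW.
pose g_ n x := ((ln 4)%:E - (ln (circ2 (r_ n) x))%:E)%E.
have mg n : measurable_fun D (g_ n) by exact: emeasurable_funB.
have g0 n x : D x -> (0 <= g_ n x)%E.
  by move=> _; rewrite /g_ -EFinD lee_fin subr_ge0 ler_ln ?posrE.
have intg n : (\int[mu]_(x in D) g_ n x = (ln 4 * (2 * pi))%:E)%E.
  rewrite integralB// int0 sube0 integral_cst// [X in (_ * X)%E]muD.
  by rewrite EFinM.
have F := fatou mu mD mg g0.
have g1 : (\int[mu]_(x in D) ((ln 4)%:E - (ln (circ2 1 x))%:E) <= (ln 4 * (2 * pi))%:E)%E.
  apply: le_trans (le_trans F _).
    rewrite le_eqVlt; apply/orP; left; apply/eqP; apply: eq_integral => x /[!inE] Dx.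
    have gcv : g_ ^~ x @ \oo --> ((ln 4)%:E - (ln (circ2 1 x))%:E)%E.
      apply: cvgeB => //; first exact: cvg_cst.
      by apply: cvg_EFin; [exact: nearW|exact: fcvg].
    apply/esym; rewrite is_cvg_limn_einfE; last by apply/cvg_ex; eexists; exact: gcv.
    exact: cvg_lim gcv.
  rewrite (_ : (fun n => _) = cst (ln 4 * (2 * pi))%:E); last by apply/funext => n; exact: intg.
  have cc : cvgn (cst (ln 4 * (2 * pi))%:E : nat -> \bar R) by exact: is_cvg_cst.
  by rewrite is_cvg_limn_einfE// lim_cst.
have i1 : mu.-integrable D (fun x => (ln (circ2 1 x))%:E).
  have : mu.-integrable D (fun x => (ln 4)%:E - (ln (circ2 1 x))%:E)%E.
    apply/integrableP; split; first exact: emeasurable_funB.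
    apply: le_lt_trans (ltry (ln 4 * (2 * pi))); apply: le_trans g1.
    rewrite le_eqVlt; apply/orP; left; apply/eqP; apply: eq_integral => x /[!inE] Dx.
    by rewrite gee0_abs// -EFinD lee_fin subr_ge0 ler_ln ?posrE// f1pos.
  move=> /(integrableB mD (ic (ln 4))); apply: eq_integrable => // x _ /=.
  by rewrite -!EFinD; congr EFin; lra.
have dom : {ae mu, forall x n, D x -> (`|(ln (circ2 (r_ n) x))%:E| <= (`|ln 4| + `|ln 4| + `|ln (circ2 1 x)|)%:E)%E}.
  apply/aeW => x n Dx; rewrite lee_fin.
  have h1 : ln (circ2 (r_ n) x) <= ln 4 by rewrite ler_ln ?posrE.
  have h2 : ln (circ2 1 x) <= ln 4 + ln (circ2 (r_ n) x).
    rewrite -lnM ?posrE// ler_ln ?posrE ?f1pos// ?mulr_gt0//.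
    have := r0 n; have := cos_le1 x; have := cos_geN1 x; rewrite /circ2.
    (* With c the cosine, 4 (1 - 2 r c + r^2) - (2 - 2 c) = 4 (r - c)^2 + 2 (1 - c) (1 + 2 c), which
       settles c >= 0. For c <= 0 the first bracket is at least 1, while 2 - 2 c is at most 4. *)
    move: (cos x) (r_ n) => c r c1 c2 r_ge0; have [c0|/ltW c0] := leP 0 c.
      have h3 : 0 <= (1 - c) * (1 + 2 * c) by rewrite mulr_ge0//; lra.
      have := sqr_ge0 (r - c); nra.
    have h3 : 0 <= r * - c by rewrite mulr_ge0// oppr_ge0.
    have := sqr_ge0 r; lra.
  have := ler_norm (ln 4 : R); have := ler_norm (- ln (circ2 1 x)); rewrite normrN.
  have := normr_ge0 (ln (circ2 1 x)).
  by have := normr_ge0 (ln 4 : R); move=> h6 h3 h4 h5; rewrite ler_norml; lra.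
have [] := @dominated_convergence _ _ _ mu _ mD (fun n x => (ln (circ2 (r_ n) x))%:E)
  (fun x => (ln (circ2 1 x))%:E) _ mln ml1 _ _ dom.
- by apply/aeW => x Dx; apply: cvg_EFin; [exact: nearW|exact: fcvg].
- have := integrableD mD (ic (`|ln 4| + `|ln 4|)) (integrable_norm i1).
  by apply: eq_integrable.
move=> _ _ lim0.
have {lim0} int1 : (\int[mu]_(x in D) (ln (circ2 1 x))%:E = 0)%E.
  move/cvg_lim : lim0 => <- //.
  rewrite (_ : (fun n => _) = cst 0%E) ?lim_cst//.
  by apply/funext => n; exact: int0.
split.
- exact: measurable_circ2.
- by move=> x; have /andP[+ _] := circ2_bounds x ler01 (lexx 1); rewrite subrr expr0n.
- apply: (@subset_measure0 _ _ _ mu _ ([set 0] `|` [set 2 * pi])) => //.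
  + by apply: measurableI => //; rewrite -[X in measurable X]setTI; exact: measurable_circ2.
  + exact: measurableU.
  + move=> x [/= /[!in_itv]/= /andP[x0 x2] fx0]; move: x0 x2.
    rewrite le_eqVlt => /predU1P[<-|x0]; first by left.
    rewrite le_eqVlt => /predU1P[->|x2]; first by right.
    by have := @f1pos x; rewrite /D/= in_itv/= x0 x2 fx0 ltxx => /(_ isT).
  + by apply: null_set_setU => //; exact: lebesgue_measure_set1.
- apply/integrableP; split.
    apply/measurable_EFinP; apply: measurable_funTS.
    by apply: measurableT_comp (measurable_circ2 _) => //; exact: measurable_ln.
  rewrite -(oc (fun x => `|(ln (circ2 1 x))%:E|%E)).
    by case/integrableP : i1.
  exact: measurableT_comp.
- by rewrite -(oc (fun x => (ln (circ2 1 x))%:E)).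
Qed.

Lemma circ2_periodic r t : circ2 r (t + 2 * pi) = circ2 r t.
Proof. by rewrite /circ2 cos_periodic. Qed.

Lemma mean_log_circ2 r : `|r| <= 1 -> mean_log (circ2 r) 0.
Proof.
have pos q : 0 <= q -> q <= 1 -> mean_log (circ2 q) 0.
  move=> q0; rewrite le_eqVlt => /predU1P[->|q1]; first exact: mean_log_circ2_1.
  exact: mean_log_circ2_lt1.
have [r0|r0] := leP 0 r; first by rewrite ger0_norm//; exact: pos.
rewrite ltr0_norm// => r1.
have := mean_log_shift pi (circ2_periodic (- r)) (pos (- r) _ r1).
rewrite oppr_ge0 => /(_ (ltW r0)); apply: eq_mean_log => t.
by rewrite /circ2 cosDpi; lra.
Qed.

End Circle.

(** * Equality of the two one-variable means *)

Section Derivatives.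
Set Implicit Arguments.
Unset Strict Implicit.
Context {R : realType}.
Implicit Types (f g : R -> R) (x a b : R).

Lemma is_derive_addf f g x a b : is_derive x 1 f a -> is_derive x 1 g b ->
  is_derive x 1 (fun y => f y + g y) (a + b).
Proof. by move=> fa gb; exact: is_deriveD. Qed.

Lemma is_derive_oppf f x a : is_derive x 1 f a -> is_derive x 1 (fun y => - f y) (- a).
Proof. by move=> fa; exact: is_deriveN. Qed.

Lemma is_derive_mulf f g x a b : is_derive x 1 f a -> is_derive x 1 g b ->
  is_derive x 1 (fun y => f y * g y) (a * g x + f x * b).
Proof.
by move=> fa gb; apply: is_derive_eq; rewrite addrC [a * _]mulrC.
Qed.

Lemma is_derive_expf f n x a : is_derive x 1 f a ->
  is_derive x 1 (fun y => f y ^+ n) (n%:R * f x ^+ n.-1 * a).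
Proof. by move=> /(is_deriveX n); rewrite exprfctE. Qed.

Lemma is_derive_invf f x a : f x != 0 -> is_derive x 1 f a ->
  is_derive x 1 (fun y => (f y)^-1) (- a / f x ^+ 2).
Proof.
by move=> fx fa; apply: is_derive_eq; rewrite mulNr mulrC -mulNr.
Qed.

Lemma is_derive_sqrtf f x a : 0 < f x -> is_derive x 1 f a ->
  is_derive x 1 (fun y => Num.sqrt (f y)) (a / (2 * Num.sqrt (f x))).
Proof.
move=> fx fa; rewrite mulrC; apply: (@is_derive1_comp _ Num.sqrt f) fa.
exact: is_derive1_sqrt.
Qed.

Lemma is_derive_lnf f x a : 0 < f x -> is_derive x 1 f a ->
  is_derive x 1 (fun y => ln (f y)) (a / f x).
Proof.
move=> fx fa; rewrite mulrC; apply: (@is_derive1_comp _ (@ln R) f) fa.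
exact: is_derive1_ln.
Qed.

Lemma is_derive_atanf f x a : is_derive x 1 f a ->
  is_derive x 1 (fun y => atan (f y)) (a / (1 + f x ^+ 2)).
Proof.
move=> fa; rewrite mulrC; apply: (@is_derive1_comp _ atan f) fa.
Qed.

Lemma is_derive_sinf f x a : is_derive x 1 f a ->
  is_derive x 1 (fun y => sin (f y)) (cos (f x) * a).
Proof. by move=> fa; apply: (@is_derive1_comp _ sin f) fa. Qed.

Lemma is_derive_cosf f x a : is_derive x 1 f a ->
  is_derive x 1 (fun y => cos (f y)) (- sin (f x) * a).
Proof. by move=> fa; apply: (@is_derive1_comp _ cos f) fa. Qed.

Lemma is_derive_idf x : is_derive x 1 (fun y : R => y) 1.
Proof. exact: is_derive_id. Qed.

Lemma is_derive_cstf (c x : R) : is_derive x 1 (fun _ : R => c) 0.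
Proof. exact: is_derive_cst. Qed.

Lemma is_derive_continuous f x a : is_derive x 1 f a -> {for x, continuous f}.
Proof.
by move=> [fd _]; apply: differentiable_continuous; exact/derivable1_diffP.
Qed.

End Derivatives.

(* is_derive is a class, and instance search diverges on the terms below or
   returns derivatives hidden under scalings; hence notypeclasses. *)
Ltac derive_fun := repeat first
  [ eassumption | notypeclasses refine (is_derive_cstf _ _)
  | notypeclasses refine (is_derive_idf _)
  | notypeclasses refine (is_derive_addf _ _) | notypeclasses refine (is_derive_oppf _)
  | notypeclasses refine (is_derive_expf _ _) | notypeclasses refine (is_derive_mulf _ _)
  | notypeclasses refine (is_derive_invf _ _) | notypeclasses refine (is_derive_sqrtf _ _)
  | notypeclasses refine (is_derive_lnf _ _) | notypeclasses refine (is_derive_atanf _)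
  | notypeclasses refine (is_derive_sinf _) | notypeclasses refine (is_derive_cosf _) ].

(** * The radicals in Jensen's formula, their K-derivatives and the Landen substitution *)

Section Period.
Set Implicit Arguments.
Unset Strict Implicit.
Context {R : realType}.
Implicit Types k v w t : R.

(** These are larger roots of quadratics: [SP] of S^2 = k S + v, then [XP] of X^2 - S X + v = 0, and
    [XR] of X^2 = k X + w (w - 3). Equivalently k = S - v / S and S = X + v / X. *)
Definition SP k v : R := (k + Num.sqrt (k ^+ 2 + 4 * v)) / 2.
Definition XP k v : R := (SP k v + Num.sqrt (SP k v ^+ 2 - 4 * v)) / 2.
Definition XR k w : R := (k + Num.sqrt (k ^+ 2 + 4 * (w * (w - 3)))) / 2.

Lemma sqrt_eq (x y : R) : 0 <= y -> x = y ^+ 2 -> Num.sqrt x = y.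
Proof. by move=> y0 ->; rewrite sqrtr_sqr ger0_norm. Qed.

Lemma sqrt_ge (x y : R) : y ^+ 2 <= x -> y <= Num.sqrt x.
Proof.
move=> yx; have x0 := le_trans (sqr_ge0 y) yx.
by apply: le_trans (ler_norm y) _; rewrite -sqrtr_sqr ler_wsqrtr.
Qed.

Lemma sqrt_le (x y : R) : 0 <= y -> x <= y ^+ 2 -> Num.sqrt x <= y.
Proof. by move=> y0 xy; rewrite -(ger0_norm y0) -sqrtr_sqr ler_wsqrtr. Qed.

(** Eliminating v by S^2 = k S + v gives S^2 - 4 v = S (4 k - 3 S). The last bound then follows from
    k <= S <= k + 1, whose upper half is k^2 + 16 <= (k + 2)^2, valid because k > 3. *)
Lemma SP_facts k v : 3 < k -> 0 <= v <= 4 ->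
  [/\ 0 < k ^+ 2 + 4 * v, Num.sqrt (k ^+ 2 + 4 * v) ^+ 2 = k ^+ 2 + 4 * v,
      k <= SP k v <= k + 1, SP k v <= Num.sqrt (k ^+ 2 + 4 * v) &
      3 * (k - 3) <= SP k v ^+ 2 - 4 * v].
Proof.
move=> k3 /andP[v0 v4].
have p : 0 < k ^+ 2 + 4 * v by nra.
have nn : Num.sqrt (k ^+ 2 + 4 * v) ^+ 2 = k ^+ 2 + 4 * v by rewrite sqr_sqrtr// ltW.
have n1 : k <= Num.sqrt (k ^+ 2 + 4 * v) by apply: sqrt_ge; lra.
have n2 : Num.sqrt (k ^+ 2 + 4 * v) <= k + 2 by apply: sqrt_le; nra.
rewrite /SP; set n := Num.sqrt _ in nn n1 n2 *.
split => //; [lra|lra|].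
have -> : ((k + n) / 2) ^+ 2 - 4 * v = (k + n) / 2 * (4 * k - 3 * ((k + n) / 2)).
  have -> : v = (n ^+ 2 - k ^+ 2) / 4 by rewrite nn; lra.
  by lra.
apply: ler_pM; lra.
Qed.

Lemma XR_pos k w : 3 < k -> (k - 3) ^+ 2 <= k ^+ 2 + 4 * (w * (w - 3)).
Proof. by move=> k3; have := sqr_ge0 (2 * w - 3); nra. Qed.

(** With n and r the outer and inner square roots, the two quadratics give dS/dk = S / n and d(ln
    X)/dS = 1 / r. *)
Lemma is_derive_lnXP k v : 3 < k -> 0 <= v <= 4 ->
  is_derive k 1 (fun k => ln (XP k v))
    (SP k v / (Num.sqrt (k ^+ 2 + 4 * v) * Num.sqrt (SP k v ^+ 2 - 4 * v))).
Proof.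
move=> k3 v04; have [p nn /andP[S1 S2] Sn q] := SP_facts k3 v04.
have q0 : 0 < SP k v ^+ 2 - 4 * v by apply: lt_le_trans q; lra.
have qq := sqr_sqrtr (ltW q0).
have n0 : 0 < Num.sqrt (k ^+ 2 + 4 * v) by rewrite sqrtr_gt0.
have r0 : 0 < Num.sqrt (SP k v ^+ 2 - 4 * v) by rewrite sqrtr_gt0.
have dS : is_derive k 1 (fun k => SP k v) (SP k v / Num.sqrt (k ^+ 2 + 4 * v)).
  rewrite /SP; notypeclasses refine (is_derive_eq _ _); first by derive_fun.
  by rewrite /=; set n := Num.sqrt _ in nn n0 *; field; rewrite lt0r_neq0.
rewrite /XP; notypeclasses refine (is_derive_eq _ _); first by derive_fun => //=; lra.
rewrite /=; move: r0 n0; set r := Num.sqrt (SP _ _ ^+ 2 - _); set n := Num.sqrt _ => r0 n0.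
by field; rewrite !lt0r_neq0//; lra.
Qed.

Lemma is_derive_lnXR k w : 3 < k ->
  is_derive k 1 (fun k => ln (XR k w)) (Num.sqrt (k ^+ 2 + 4 * (w * (w - 3))))^-1.
Proof.
move=> k3; have q := XR_pos w k3.
have q0 : 0 < k ^+ 2 + 4 * (w * (w - 3)) by apply: lt_le_trans q; rewrite exprn_gt0// subr_gt0.
have r0 : 0 < Num.sqrt (k ^+ 2 + 4 * (w * (w - 3))) by rewrite sqrtr_gt0.
rewrite /XR; notypeclasses refine (is_derive_eq _ _); first by derive_fun => //=; lra.
rewrite /=; move: r0; set r := Num.sqrt _ => r0.
by field; rewrite !lt0r_neq0//; lra.
Qed.


Lemma landen_den_gt0 (n k c : R) : 0 < k <= n -> -1 <= c <= 1 ->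
  0 < n * (1 + c) + k * (1 - c).
Proof. by move=> /andP[k0 kn] /andP[c1 c2]; nra. Qed.

(* tan (psi / 2) = K / sqrt (K^2 + 4 w) * tan (t / 2), written so that it is
   smooth in t and psi - t is 2 pi-periodic. *)
Definition landen k t : R :=
  let n := Num.sqrt (k ^+ 2 + 4 * (2 + 2 * cos t)) in
  t - 2 * atan ((n - k) * sin t / (n * (1 + cos t) + k * (1 - cos t))).

Definition dlanden k t : R :=
  let w := 2 + 2 * cos t in
  k * (k ^+ 2 + 8 * w - w ^+ 2) / (Num.sqrt (k ^+ 2 + 4 * w) * (k ^+ 2 + w ^+ 2)).

Lemma landen_facts k t : 3 < k -> let n := Num.sqrt (k ^+ 2 + 4 * (2 + 2 * cos t)) in
  [/\ 0 < k ^+ 2 + 4 * (2 + 2 * cos t), n ^+ 2 = k ^+ 2 + 4 * (2 + 2 * cos t),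
     k <= n, 0 < n & 0 < n * (1 + cos t) + k * (1 - cos t)].
Proof.
move=> k3 n; have c1 := cos_geN1 t; have c2 := cos_le1 t.
have p : 0 < k ^+ 2 + 4 * (2 + 2 * cos t) by nra.
have n1 : k <= n by apply: sqrt_ge; lra.
split => //; first by rewrite sqr_sqrtr// ltW.
- by lra.
- by apply: landen_den_gt0; rewrite ?n1 ?c1 ?c2//; lra.
Qed.

Lemma is_derive_landen k t : 3 < k -> is_derive t 1 (landen k) (dlanden k t).
Proof.
move=> k3; have [p nn kn n0 d0] := landen_facts t k3.
have s2 := sin2cos2 t.
rewrite /landen /dlanden.
set n := Num.sqrt _ in nn kn n0 d0 *; set c := cos t in s2 nn p d0 *; set s := sin t in s2 *.
set d := n * _ + _ in d0.
have dn : is_derive t 1 (fun t => Num.sqrt (k ^+ 2 + 4 * (2 + 2 * cos t))) (- 4 * s / n).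
  notypeclasses refine (is_derive_eq _ _); first by derive_fun.
  by rewrite /= -/n -/c -/s; field; exact: lt0r_neq0.
have dq : is_derive t 1 (fun t => (Num.sqrt (k ^+ 2 + 4 * (2 + 2 * cos t)) - k) * sin t /
      (Num.sqrt (k ^+ 2 + 4 * (2 + 2 * cos t)) * (1 + cos t) + k * (1 - cos t)))
    ((- 8 * k * s ^+ 2 / n + (n - k) * (c * d + (n - k) * s ^+ 2)) / d ^+ 2).
  notypeclasses refine (is_derive_eq _ _); first by derive_fun => //; exact: lt0r_neq0.
  by rewrite /= -/n -/c -/s /d; field; rewrite !lt0r_neq0.
(* Replacing the cosine by its expression in [n] turns the remaining identities into rational ones
   in [n] and [k], with no radical left. *)
have cE : c = (n ^+ 2 - k ^+ 2) / 8 - 1 by rewrite nn; lra.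
pose D := k ^+ 2 + (2 + 2 * c) ^+ 2.
have D0 : 0 < D by rewrite ltr_pwDl ?sqr_ge0// exprn_gt0//; lra.
(* The arctangent is (t - psi) / 2, and [d] and [(n - k) * s] are its cosine and sine scaled by 2
   sqrt [D]; hence the sum of their squares is [4 * D]. *)
have E : 1 + ((n - k) * s / d) ^+ 2 = 4 * D / d ^+ 2.
  rewrite (_ : ((n - k) * s / d) ^+ 2 = (n - k) ^+ 2 * s ^+ 2 / d ^+ 2); last first.
    by field; exact: lt0r_neq0.
  have dE : d ^+ 2 + (n - k) ^+ 2 * s ^+ 2 = 4 * D.
    by rewrite s2 /D /d cE; field.
  by rewrite -dE mulrDl divff// expf_neq0// lt0r_neq0.
notypeclasses refine (is_derive_eq _ _); first by derive_fun.
rewrite /= -/n -/c -/s -/d E s2 -/D.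
rewrite (_ : k ^+ 2 + 8 * (2 + 2 * c) - (2 + 2 * c) ^+ 2 = n ^+ 2 + 4 * (1 - c ^+ 2)); last by rewrite nn; lra.
have -> : (- 8 * k * (1 - c ^+ 2) / n + (n - k) * (c * d + (n - k) * (1 - c ^+ 2))) =
   2 * D - 2 * n * k - 8 * k * (1 - c ^+ 2) / n.
  by rewrite /d /D cE; field; exact: lt0r_neq0.
by field; rewrite !lt0r_neq0.
Qed.

(** The double-angle formulas for the arctangent collapse to sin psi = k n sin t / (k^2 + w^2), with
    n^2 = k^2 + 4 w. Squaring removes n, so v becomes a rational function of k and w. *)
Lemma sin_landen k t : 3 < k -> let w := 2 + 2 * cos t in
  4 * sin (landen k t) ^+ 2 = k ^+ 2 * (w * (4 - w)) * (k ^+ 2 + 4 * w) / (k ^+ 2 + w ^+ 2) ^+ 2.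
Proof.
move=> k3 w; have [p nn kn n0 d0] := landen_facts t k3.
have s2 := sin2cos2 t.
rewrite /landen /w.
set n := Num.sqrt _ in nn kn n0 d0 *; set c := cos t in s2 nn p d0 *; set s := sin t in s2 *.
set d := n * _ + _ in d0 *.
have cE : c = (n ^+ 2 - k ^+ 2) / 8 - 1 by rewrite nn; lra.
pose D := k ^+ 2 + (2 + 2 * c) ^+ 2.
have D0 : 0 < D by rewrite ltr_pwDl ?sqr_ge0// exprn_gt0//; lra.
rewrite -nn -/D.
set q := (n - k) * s / d.
have q2 : q ^+ 2 = (n - k) ^+ 2 * (1 - c ^+ 2) / d ^+ 2.
  by rewrite -s2 /q; field; exact: lt0r_neq0.
have d2 : d ^+ 2 = 4 * D - (n - k) ^+ 2 * (1 - c ^+ 2).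
  by rewrite /D /d cE; field.
have a0 : 0 < 1 + q ^+ 2 by rewrite ltr_pwDl ?sqr_ge0.
have ca : cos (atan q) != 0.
  by rewrite cos_atan invr_neq0// sqrtr_eq0 -ltNge.
have ta : sin (atan q) = q * cos (atan q).
  by rewrite -[X in X * _]atanK /tan mulfVK.
have c2 : cos (atan q) ^+ 2 = (1 + q ^+ 2)^-1.
  by rewrite cos_atan exprVn sqr_sqrtr// ltW.
have E : 1 + q ^+ 2 = 4 * D / d ^+ 2.
  by rewrite q2 d2; field; rewrite -d2 expf_neq0// lt0r_neq0.
have sinE : sin (t - 2 * atan q) = s * k * n / D.
  rewrite sinB (_ : 2 * atan q = atan q *+ 2); last by rewrite mulr_natl.
  rewrite sin_mulr2n cos_mulr2n ta -/s -/c.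
  have -> : cos (atan q) * (q * cos (atan q)) *+ 2 = 2 * q * cos (atan q) ^+ 2 by ring.
  rewrite c2 E (_ : (4 * D / d ^+ 2)^-1 = d ^+ 2 / (4 * D)); last first.
    by field; rewrite !lt0r_neq0.
  have -> : 2 * q * (d ^+ 2 / (4 * D)) = (n - k) * s * d / (2 * D).
    by rewrite /q; field; rewrite !lt0r_neq0.
  have kn2 : 2 * n * k = d * (n + k) - 2 * D by rewrite /D /d cE; field.
  have -> : s * k * n / D = s * (2 * n * k) / (2 * D) by field; exact: lt0r_neq0.
  by rewrite kn2 /d; field; exact: lt0r_neq0.
rewrite sinE (_ : 4 * (s * k * n / D) ^+ 2 = k ^+ 2 * (4 * s ^+ 2) * n ^+ 2 / D ^+ 2); last first.
  by field; exact: lt0r_neq0.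
by congr (_ * _ * _ / _); rewrite s2; ring.
Qed.

Definition dlnXP k v : R :=
  SP k v / (Num.sqrt (k ^+ 2 + 4 * v) * Num.sqrt (SP k v ^+ 2 - 4 * v)).

(** At this v, k^2 + 4 v is a perfect square in w, S = k n^2 / (k^2 + w^2), and sqrt (S^2 - 4 v) = k
    n r / (k^2 + w^2), where r is the radical on the right-hand side. Every other factor cancels
    against [dlanden]. *)
Lemma landen_period k t : 3 < k -> let w := 2 + 2 * cos t in
  dlnXP k (4 * sin (landen k t) ^+ 2) * dlanden k t =
  (Num.sqrt (k ^+ 2 + 4 * (w * (w - 3))))^-1.
Proof.
move=> k3 w; have [p _ _ _ _] := landen_facts t k3.
have c1 := cos_geN1 t; have c2 := cos_le1 t.
have w0 : 0 <= w <= 4 by rewrite /w; lra.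
move: w0 p; rewrite sin_landen// /dlanden -/w; move: w => w /andP[w0 w4] p.
set n := Num.sqrt (k ^+ 2 + 4 * w).
have n0 : 0 < n by rewrite sqrtr_gt0.
have nn : k ^+ 2 + 4 * w = n ^+ 2 by rewrite sqr_sqrtr// ltW.
have k0 : 0 < k by lra.
pose D := k ^+ 2 + w ^+ 2; have D0 : 0 < D by rewrite ltr_pwDl ?sqr_ge0// exprn_gt0.
have Q0 : 0 < k ^+ 2 + 4 * (w * (w - 3)).
  by apply: lt_le_trans (XR_pos w k3); rewrite exprn_gt0// subr_gt0.
pose r := Num.sqrt (k ^+ 2 + 4 * (w * (w - 3))).
have r0 : 0 < r by rewrite sqrtr_gt0.
have rr : k ^+ 2 + 4 * (w * (w - 3)) = r ^+ 2 by rewrite sqr_sqrtr// ltW.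
have e0 : 0 < k ^+ 2 + 8 * w - w ^+ 2.
  have : 0 <= w * (8 - w) by rewrite mulr_ge0//; lra.
  by have := exprn_gt0 2 k0; lra.
set v := (X in dlnXP k X).
have sv : Num.sqrt (k ^+ 2 + 4 * v) = k * (k ^+ 2 + 8 * w - w ^+ 2) / D.
  apply: sqrt_eq; first by rewrite divr_ge0// ?mulr_ge0 ?ltW.
  by rewrite /v -/D /D; field; exact: lt0r_neq0.
have SE : SP k v = k * n ^+ 2 / D.
  by rewrite /SP sv -nn /D; field; exact: lt0r_neq0.
have qE : Num.sqrt (SP k v ^+ 2 - 4 * v) = k * n * r / D.
  apply: sqrt_eq; first by rewrite divr_ge0// ?mulr_ge0 ?ltW.
  have -> : (k * n * r / D) ^+ 2 = k ^+ 2 * n ^+ 2 * r ^+ 2 / D ^+ 2 by field; exact: lt0r_neq0.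
  by rewrite SE -rr -nn /v -/D /D; field; exact: lt0r_neq0.
rewrite /dlnXP qE sv SE -/D -/r.
by field; rewrite !lt0r_neq0.
Qed.

Lemma landen0 k : landen k 0 = 0.
Proof. by rewrite /landen sin0 mulr0 mul0r atan0 mulr0 subr0. Qed.

Lemma landen2pi k : landen k (2 * pi) = 2 * pi.
Proof.
by rewrite /landen (_ : sin (2 * pi) = 0) ?mulr0 ?mul0r ?atan0 ?mulr0 ?subr0// mulr_natl sin2pi.
Qed.

Lemma continuous_dlanden k : 3 < k -> continuous (dlanden k).
Proof.
move=> k3 t; have [p _ _ n0 _] := landen_facts t k3.
notypeclasses refine (is_derive_continuous _); first by rewrite /dlanden; derive_fun => //;
  rewrite mulf_neq0// ?lt0r_neq0// ltr_pwDl ?sqr_ge0// exprn_gt0//; lra.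
Qed.

Lemma dlanden_gt0 k t : 3 < k -> 0 < dlanden k t.
Proof.
move=> k3; have [p _ _ n0 _] := landen_facts t k3; rewrite /dlanden.
have c1 := cos_geN1 t; have c2 := cos_le1 t.
rewrite divr_gt0// ?mulr_gt0//; first by lra.
- have : 0 <= (1 + cos t) * (3 - cos t) by rewrite mulr_ge0//; lra.
  by have k0 : 0 < k ^+ 2 by [rewrite exprn_gt0//; lra]; lra.
- by rewrite ltr_pwDl ?sqr_ge0// exprn_gt0//; lra.
Qed.

Lemma sin2_04 t : 0 <= 4 * sin t ^+ 2 <= 4.
Proof. by have := sqr_ge0 (sin t); have := sqr_ge0 (cos t); have := cos2Dsin2 t; lra. Qed.

Lemma continuous_dXP k : 3 < k -> continuous (fun t => dlnXP k (4 * sin t ^+ 2)).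
Proof.
move=> k3 t; have [p _ /andP[S1 S2] _ q] := SP_facts k3 (sin2_04 t).
have q0 : 0 < SP k (4 * sin t ^+ 2) ^+ 2 - 4 * (4 * sin t ^+ 2) by apply: lt_le_trans q; lra.
notypeclasses refine (is_derive_continuous _); first by rewrite /dlnXP /SP; derive_fun => //;
  rewrite mulf_neq0// lt0r_neq0// sqrtr_gt0.
Qed.

Notation mu := (@lebesgue_measure R).
Notation I2pi := (`[0%R, (2 * pi)%R]%classic : set R).

Lemma integral_landen k : 3 < k ->
  (\int[mu]_(t in I2pi) (dlnXP k (4 * sin t ^+ 2))%:E =
   \int[mu]_(t in I2pi) (Num.sqrt (k ^+ 2 + 4 * ((2 + 2 * cos t) * (2 + 2 * cos t - 3))))^-1%:E)%E.
Proof.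
move=> k3; have pi0 := pi_gt0 R.
have dl t := is_derive_landen t k3.
have lE : derive1 (landen k) = dlanden k.
  by apply/funext => t; rewrite derive1E; case: (dl t).
have lc : continuous (landen k) by move=> t; exact: is_derive_continuous (dl t).
have ld t : derivable (landen k) t 1 by case: (dl t).
have := @integration_by_substitution_increasing R (landen k)
  (fun t => dlnXP k (4 * sin t ^+ 2)) 0 (2 * pi).
rewrite landen0 landen2pi => ->.
- apply: eq_integral => t _; rewrite lE; congr EFin.
  by rewrite -landen_period.
- by rewrite mulr_ge0// pi_ge0.
- move=> x y _ _ xy.
  apply: (gtr0_derive1_lt_cc (f := landen k) (a := x) (b := y)) => //.
  + by move=> z _; rewrite lE; exact: dlanden_gt0.
  + exact: continuous_subspaceT.
  + by rewrite in_itv/= lexx ltW.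
  + by rewrite in_itv/= lexx ltW.
- by rewrite lE => x _; exact: continuous_dlanden.
- rewrite lE; apply/cvg_ex; exists (dlanden k 0).
  by apply: cvg_at_right_filter; exact: continuous_dlanden.
- rewrite lE; apply/cvg_ex; exists (dlanden k (2 * pi)).
  by apply: cvg_at_left_filter; exact: continuous_dlanden.
- split => //.
  + by apply: cvg_at_right_filter; exact: lc.
  + by apply: cvg_at_left_filter; exact: lc.
- by apply: continuous_subspaceT; exact: continuous_dXP.
Qed.

Definition jensenP k : R := \int[mu]_(t in I2pi) ln (XP k (4 * sin t ^+ 2)).
Definition jensenR k : R := \int[mu]_(t in I2pi) ln (XR k (2 + 2 * cos t)).

Lemma continuous_integrable_I2pi (f : R -> R) :
  continuous f -> mu.-integrable I2pi (EFin \o f).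
Proof.
move=> cf; apply: continuous_compact_integrable; first exact: segment_compact.
exact: continuous_subspaceT.
Qed.

Lemma XP_bounds k v : 3 < k -> 0 <= v <= 4 -> k / 2 <= XP k v <= k + 1.
Proof.
move=> k3 v04; have [p nn /andP[S1 S2] Sn q] := SP_facts k3 v04.
have v0 : 0 <= v by case/andP: v04.
rewrite /XP; have := sqrtr_ge0 (SP k v ^+ 2 - 4 * v).
have : Num.sqrt (SP k v ^+ 2 - 4 * v) <= SP k v by apply: sqrt_le; lra.
lra.
Qed.

Lemma XP_ge k v : 4 <= k -> 0 <= v <= 4 -> k - 2 <= XP k v.
Proof.
move=> k4 v04; have k3 : 3 < k by lra.
have [p nn /andP[S1 S2] Sn q] := SP_facts k3 v04.
have : SP k v - 4 <= Num.sqrt (SP k v ^+ 2 - 4 * v) by apply: sqrt_ge; lra.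
rewrite /XP; lra.
Qed.

Lemma XR_bounds k w : 3 < k -> 0 <= w <= 4 -> k - 3 / 2 <= XR k w <= k + 1.
Proof.
move=> k3 /andP[w0 w4]; have := sqrt_ge (XR_pos w k3).
have h : 0 <= (w + 1) * (4 - w) by rewrite mulr_ge0//; lra.
have : Num.sqrt (k ^+ 2 + 4 * (w * (w - 3))) <= k + 2 by apply: sqrt_le; lra.
rewrite /XR; lra.
Qed.

Lemma continuous_lnXP k : 3 < k -> continuous (fun t => ln (XP k (4 * sin t ^+ 2))).
Proof.
move=> k3 t; have [p _ /andP[S1 S2] _ q] := SP_facts k3 (sin2_04 t).
have /andP[x0 _] := XP_bounds k3 (sin2_04 t).
have q0 : 0 < SP k (4 * sin t ^+ 2) ^+ 2 - 4 * (4 * sin t ^+ 2) by apply: lt_le_trans q; lra.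
notypeclasses refine (is_derive_continuous _); first rewrite /XP /SP; derive_fun => //.
by apply: lt_le_trans x0; lra.
Qed.

Lemma cos2_04 t : 0 <= 2 + 2 * cos t <= 4.
Proof. by have := cos_geN1 t; have := cos_le1 t; lra. Qed.

Lemma continuous_lnXR k : 3 < k -> continuous (fun t => ln (XR k (2 + 2 * cos t))).
Proof.
move=> k3 t; have /andP[x0 _] := XR_bounds k3 (cos2_04 t).
have q := XR_pos (2 + 2 * cos t) k3.
notypeclasses refine (is_derive_continuous _); first rewrite /XR; derive_fun => //.
- by apply: lt_le_trans x0; lra.
- by apply: lt_le_trans q; rewrite exprn_gt0// subr_gt0.
Qed.

(** Differentiation under the integral sign, dominated near [k] by the constant [C u] with u midway
    between 3 and [k]. The bound is indexed by [u] because it may blow up at 3. *)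
Lemma is_derive_integral_I2pi (f f' : R -> R -> R) k (C : R -> R) : 3 < k ->
  (forall k, 3 < k -> continuous (f k)) ->
  (forall k t, 3 < k -> is_derive k 1 (f ^~ t) (f' k t)) ->
  (forall u k t, 3 < u -> u < k -> `|f' k t| <= C u) ->
  is_derive k 1 (fun k => \int[mu]_(t in I2pi) f k t) (\int[mu]_(t in I2pi) f' k t).
Proof.
move=> k3 fc fd fC; pose u := (3 + k) / 2.
have u3 : 3 < u by rewrite /u; lra.
have uk : `]u, (k + 1)[%classic k by rewrite /= in_itv/= /u; lra.
have I3 x : `]u, (k + 1)[%classic x -> u < x /\ 3 < x.
  by rewrite /= in_itv/= => /andP[ux _]; split => //; exact: lt_trans ux.
have mI : measurable I2pi by exact: measurable_itv.
have C0 : 0 <= C u by apply: le_trans (fC u k 0 u3 _); rewrite ?normr_ge0// /u; lra.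
have pE x t : 3 < x -> partial1of2 f x t = f' x t.
  by move=> x3; rewrite partial1of2E; case: (fd x t x3).
have intf x : `]u, (k + 1)[%classic x -> mu.-integrable I2pi (EFin \o f x).
  by move=> /I3[_ x3]; apply: continuous_integrable_I2pi; exact: fc.
have derf x t : `]u, (k + 1)[%classic x -> I2pi t -> derivable (f ^~ t) x 1.
  by move=> /I3[_ x3] _; case: (fd x t x3).
have intC : mu.-integrable I2pi (EFin \o cst (C u)).
  by apply: continuous_integrable_I2pi => t; exact: cvg_cst.
have ub x t : `]u, (k + 1)[%classic x -> I2pi t -> `|partial1of2 f x t| <= cst (C u) t.
  by move=> /I3[ux x3] _; rewrite pE//; exact: fC.
have G0 t : 0 <= cst (C u) t by [].
have D := @derivable_under_integral R _ (measurableTypeR R) mu f I2pi mI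
  k u (k + 1) uk intf derf _ G0 intC ub.
apply: DeriveDef; first exact: D.
rewrite -derive1E (@differentiation_under_integral R _ (measurableTypeR R) mu f I2pi mI
  k u (k + 1) uk intf derf _ G0 intC ub).
by apply: eq_Rintegral => t _; rewrite pE.
Qed.

Lemma is_derive_jensenP k : 3 < k ->
  is_derive k 1 jensenP (\int[mu]_(t in I2pi) dlnXP k (4 * sin t ^+ 2)).
Proof.
move=> k3; apply: (@is_derive_integral_I2pi (fun k t => ln (XP k (4 * sin t ^+ 2)))
  (fun k t => dlnXP k (4 * sin t ^+ 2)) k (fun u => (Num.sqrt (3 * (u - 3)))^-1)) => //.
- exact: continuous_lnXP.
- by move=> x t x3; apply: is_derive_lnXP => //; exact: sin2_04.
- move=> u x t u3 ux; have x3 := lt_trans u3 ux.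
  have [p nn /andP[S1 S2] Sn q] := SP_facts x3 (sin2_04 t).
  rewrite /dlnXP; set S := SP _ _ in S1 S2 Sn q *; set n := Num.sqrt (_ + _) in Sn *.
  have n0 : 0 < n by rewrite sqrtr_gt0.
  have h0 : 0 < Num.sqrt (3 * (u - 3)) by rewrite sqrtr_gt0; lra.
  have h1 : Num.sqrt (3 * (u - 3)) <= Num.sqrt (S ^+ 2 - 4 * (4 * sin t ^+ 2)).
    by rewrite ler_wsqrtr//; apply: le_trans q; lra.
  have r0 := lt_le_trans h0 h1.
  have S0 : 0 <= S by lra.
  rewrite ger0_norm; last by rewrite divr_ge0// mulr_ge0// ltW.
  rewrite invfM [S * _]mulrA; apply: le_trans (_ : 1 / Num.sqrt (S ^+ 2 - 4 * (4 * sin t ^+ 2)) <= _).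
    apply: ler_wpM2r; first by rewrite invr_ge0 ltW.
    by rewrite ler_pdivrMr// mul1r.
  by rewrite div1r lef_pV2 ?posrE.
Qed.

Lemma is_derive_jensenR k : 3 < k -> is_derive k 1 jensenR
  (\int[mu]_(t in I2pi) (Num.sqrt (k ^+ 2 + 4 * ((2 + 2 * cos t) * (2 + 2 * cos t - 3))))^-1).
Proof.
move=> k3; apply: (@is_derive_integral_I2pi (fun k t => ln (XR k (2 + 2 * cos t)))
  (fun k t => (Num.sqrt (k ^+ 2 + 4 * ((2 + 2 * cos t) * (2 + 2 * cos t - 3))))^-1)
  k (fun u => (u - 3)^-1)) => //.
- exact: continuous_lnXR.
- by move=> x t x3; exact: is_derive_lnXR.
- move=> u x t u3 ux; have x3 := lt_trans u3 ux.
  have h := sqrt_ge (XR_pos (2 + 2 * cos t) x3).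
  rewrite ger0_norm ?invr_ge0 ?sqrtr_ge0// lef_pV2 ?posrE//; lra.
Qed.

Lemma jensenP_eq_jensenR k : 3 < k -> jensenP k = jensenR k.
Proof.
move=> k3; apply/eqP; rewrite -subr_eq0; apply/eqP.
pose G x := jensenP x - jensenR x.
have dG (x : R) : 3 < x -> is_derive x 1 G 0.
  move=> x3; notypeclasses refine (is_derive_eq _ _).
    notypeclasses refine (is_derive_addf (is_derive_jensenP x3) (is_derive_oppf (is_derive_jensenR x3))).
  by rewrite /Rintegral integral_landen// subrr.
have Gc (x : R) : k < x -> G x = G k.
  move=> kx.
  have [||c _ /eqP] := @MVT R G (fun=> 0) k x kx.
  - by move=> y; rewrite in_itv/= => /andP[ky _]; apply: dG; exact: lt_trans ky.
  - apply: derivable_within_continuous => y; rewrite in_itv/= => /andP[ky _].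
    by case: (dG y (lt_le_trans k3 ky)).
  - by rewrite mul0r subr_eq0 => /eqP.
have Gb (x : R) : 4 <= x -> `|G x| <= 2 * pi * (3 / (x - 2)).
  move=> x4; have x3 : 3 < x by lra.
  (* Both quantities lie in [x - 2, x + 1], so their logarithms differ by at most ln (1 + 3 / (x -
     2)) <= 3 / (x - 2). *)
  have pw t : `|ln (XP x (4 * sin t ^+ 2)) - ln (XR x (2 + 2 * cos t))| <= 3 / (x - 2).
    have /andP[_ p2] := XP_bounds x3 (sin2_04 t); have p1 := XP_ge x4 (sin2_04 t).
    have /andP[r1 r2] := XR_bounds x3 (cos2_04 t).
    have l y : x - 2 <= y -> y <= x + 1 -> ln (x - 2) <= ln y <= ln (x - 2) + 3 / (x - 2).
      move=> y1 y2; rewrite ler_ln ?posrE ?y1/=; [|lra|lra].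
      apply: (@le_trans _ _ (ln (x - 2) + ln (1 + 3 / (x - 2)))); last first.
        by rewrite lerD2l le_ln1Dx// (lt_le_trans (_ : -1 < 0))// divr_ge0//; lra.
      have h : 0 <= 3 / (x - 2) by rewrite divr_ge0//; lra.
      rewrite -lnM ?posrE; [|lra|lra].
      have -> : (x - 2) * (1 + 3 / (x - 2)) = x + 1 by field; apply: lt0r_neq0; lra.
      by rewrite ler_ln ?posrE//; lra.
    have := l _ p1 p2; have := l (XR x (2 + 2 * cos t)) _ r2.
    by move=> /(_ ltac:(lra)) h1 h2; rewrite ler_norml; lra.
  have iP := continuous_integrable_I2pi (continuous_lnXP x3).
  have iR := continuous_integrable_I2pi (continuous_lnXR x3).
  have iC : mu.-integrable I2pi (EFin \o cst (3 / (x - 2))).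
    by apply: continuous_integrable_I2pi => t; exact: cvg_cst.
  have mI : measurable (I2pi : set (measurableTypeR R)) by exact: measurable_itv.
  rewrite /G /jensenP /jensenR -RintegralB//.
  have iB := integrableB mI iP iR.
  apply: le_trans (le_normr_Rintegral _ _) _ => //.
  have -> : 2 * pi * (3 / (x - 2)) = \int[mu]_(t in I2pi) (3 / (x - 2)).
    rewrite Rintegral_cst//= mulrC; congr (_ * _).
    by rewrite lebesgue_measure_itv/= lte_fin mulr_gt0 ?pi_gt0//= subr0.
  apply: le_Rintegral => //; exact: integrable_norm iB.
apply: contrapT => /eqP; rewrite -/(G k) -normr_gt0 => g0.
(* Chosen so that x - 2 > 6 pi / |G k|, which makes the bound on |G x| = |G k| smaller than |G
   k|. *)
pose x := k + 4 + 6 * pi / `|G k|.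
have h0 : 0 < 6 * pi / `|G k| by rewrite divr_gt0// mulr_gt0// pi_gt0.
have := Gb x; rewrite Gc; last by rewrite /x; lra.
move=> /(_ ltac:(rewrite /x; lra)); apply/negP; rewrite -ltNge.
rewrite mulrA ltr_pdivrMr; last by rewrite /x; lra.
have e : `|G k| * (6 * pi / `|G k|) = 6 * pi by rewrite mulrC divfK// lt0r_neq0.
have : 0 < `|G k| * (k + 2) by rewrite mulr_gt0//; lra.
by rewrite /x; lra.
Qed.

End Period.

(** * Jensen's formula on the torus *)

Section Torus.
Set Implicit Arguments.
Unset Strict Implicit.
Context {R : realType}.
Notation mu := (@lebesgue_measure R).
Notation I2pi := (`[0%R, (2 * pi)%R]%classic : set R).
Notation RT := (measurableTypeR R).
Notation RR := (measurableTypeR R * measurableTypeR R)%type.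

Lemma integral_box1 (h : RR -> \bar R) : measurable_fun setT h -> (forall z, (0 <= h z)%E) ->
  (\int[mu \x mu]_(z in I2pi `*` I2pi) h z =
   \int[mu]_(x in I2pi) \int[mu]_(y in I2pi) h (x, y))%E.
Proof.
move=> mh h0; have mI : measurable (I2pi : set RT) by exact: measurable_itv.
have mA : measurable ((I2pi : set RT) `*` (I2pi : set RT)) by exact: measurableX.
rewrite integral_mkcond fubini_tonelli1; last 2 first.
- by apply/(measurable_restrictT _ mA); exact: measurable_funTS.
- by move=> z; rewrite /patch; case: ifP.
rewrite [RHS]integral_mkcond; apply: eq_integral => x _.
rewrite /fubini_F /patch/=; case: ifPn => xI.
  rewrite [RHS]integral_mkcond; apply: eq_integral => y _.
  by rewrite /patch in_setX/= xI.
by apply: integral0_eq => y _; rewrite in_setX/= (negbTE xI).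
Qed.

Lemma integral_box2 (h : RR -> \bar R) : measurable_fun setT h -> (forall z, (0 <= h z)%E) ->
  (\int[mu \x mu]_(z in I2pi `*` I2pi) h z =
   \int[mu]_(y in I2pi) \int[mu]_(x in I2pi) h (x, y))%E.
Proof.
move=> mh h0; have mI : measurable (I2pi : set RT) by exact: measurable_itv.
have mA : measurable ((I2pi : set RT) `*` (I2pi : set RT)) by exact: measurableX.
rewrite integral_mkcond fubini_tonelli2; last 2 first.
- by apply/(measurable_restrictT _ mA); exact: measurable_funTS.
- by move=> z; rewrite /patch; case: ifP.
rewrite [RHS]integral_mkcond; apply: eq_integral => x _.
rewrite /fubini_G /patch/=; case: ifPn => xI.
  rewrite [RHS]integral_mkcond; apply: eq_integral => y _.
  by rewrite /patch in_setX/= xI andbT.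
by apply: integral0_eq => y _; rewrite in_setX/= (negbTE xI) andbF.
Qed.

(** [G] is bounded above only, so Tonelli's theorem is applied to [M - G], twice: once to iterate
    with the second angle inside, once to exchange the order. The shear is a translation of the
    inner angle with the outer one fixed, so only periodicity in the second angle is used, and a
    shift such as [a / 2] is allowed. *)
Lemma integral_torus_shear (G : R -> R -> R) (M : R) (sigma I : R -> R) (J : R) :
  measurable_fun (setT : set RR) (fun z : RR => G z.1 z.2) ->
  measurable_fun setT sigma ->
  (forall a b, G a b <= M) -> (forall a b, G a (b + 2 * pi) = G a b) ->
  (forall b, mu.-integrable I2pi (fun a => (G a (b + sigma a))%:E) /\
     (\int[mu]_(a in I2pi) (G a (b + sigma a))%:E = (I b)%:E)%E) ->
  mu.-integrable I2pi (EFin \o I) ->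
  (\int[mu]_(b in I2pi) (I b)%:E = J%:E)%E ->
  (\int[mu \x mu]_(z in I2pi `*` I2pi) (G z.1 z.2)%:E = J%:E)%E.
Proof.
move=> mG ms GM Gper GI iI IJ.
have mI : measurable (I2pi : set RT) by exact: measurable_itv.
have mA : measurable ((I2pi : set RT) `*` (I2pi : set RT)) by exact: measurableX.
pose H (z : RR) := (M - G z.1 z.2)%:E.
have mH : measurable_fun setT H by apply/measurable_EFinP; exact: measurable_funB.
have H0 z : (0 <= H z)%E by rewrite lee_fin subr_ge0.
pose sh (z : RR) : RR := (z.1, z.2 + sigma z.1).
have msh : measurable_fun setT sh.
  apply: measurable_fun_pair => //; apply: measurable_funD => //.
  exact: measurableT_comp ms _.
have ic (c : R) : mu.-integrable I2pi (fun=> c%:E).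
  apply: (measurable_bounded_integrable (f := cst c)) => //; first exact: mu_I2pi_fin.
  by exists `|c|; split; rewrite ?num_real// => y cy x _ /=; exact: ltW.
have intc (c : R) : (\int[mu]_(x in I2pi) c%:E = (c * (2 * pi))%:E)%E.
  by rewrite integral_cst//= EFinM; congr (_ * _)%E; exact: mu_I2pi.
pose T := M * (2 * pi) * (2 * pi) - J.
have HT : (\int[mu \x mu]_(z in I2pi `*` I2pi) H z = T%:E)%E.
  rewrite integral_box1//.
  transitivity (\int[mu]_(x in I2pi) \int[mu]_(y in I2pi) (H \o sh) (x, y))%E.
    apply: eq_integral => x _.
    rewrite -(ge0_integral_periodic (sigma x) (f := fun y => H (x, y)))//.
    - exact: measurableT_comp mH (measurable_pair1 x).
    - by move=> y; rewrite /H/= Gper.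
  have mHs : measurable_fun setT (H \o sh) by exact: measurableT_comp.
  rewrite -(integral_box1 mHs (fun z => H0 (sh z))).
  rewrite (integral_box2 mHs (fun z => H0 (sh z))).
  transitivity (\int[mu]_(y in I2pi) ((M * (2 * pi))%:E - (I y)%:E))%E.
    apply: eq_integral => y _; have [iG eG] := GI y.
    transitivity (\int[mu]_(x in I2pi) (M%:E - (G x (y + sigma x))%:E))%E.
      by apply: eq_integral => x _; rewrite -EFinB.
    by rewrite integralB// intc eG.
  by rewrite integralB// intc IJ -EFinB.
have muA : ((mu \x mu) (I2pi `*` I2pi) = ((2 * pi) * (2 * pi))%:E)%E.
  rewrite product_measure1E//= EFinM; congr (_ * _)%E; exact: mu_I2pi.
have iM : (mu \x mu)%E.-integrable (I2pi `*` I2pi) (fun=> M%:E).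
  apply: (measurable_bounded_integrable (f := cst M)) => //.
    by rewrite [X in (X < _)%E]muA ltry.
  by exists `|M|; split; rewrite ?num_real// => y cy x _ /=; exact: ltW.
have iH : (mu \x mu)%E.-integrable (I2pi `*` I2pi) H.
  apply/integrableP; split; first exact: measurable_funTS.
  rewrite (eq_integral H); last by move=> z _; rewrite gee0_abs.
  by rewrite HT ltry.
transitivity (\int[mu \x mu]_(z in I2pi `*` I2pi) (M%:E - H z))%E.
  by apply: eq_integral => z _; rewrite /H -EFinB; congr EFin; ring.
rewrite integralB// HT integral_cst//=.
rewrite [X in (_ * X)%E]muA -EFinM -EFinB /T; congr EFin; ring.
Qed.

End Torus.

(** * Jensen's formula for the sheared polynomials with one angle fixed *)

Section Jensen.
Set Implicit Arguments.
Unset Strict Implicit.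
Context {R : realType}.
Notation mu := (@lebesgue_measure R).
Notation I2pi := (`[0%R, (2 * pi)%R]%classic : set R).

(* Used for P_k, whose factor is linear in cos (a / 2): the product with its
   reflection a |-> 2 pi - a is a polynomial in cos a. *)
Lemma mean_log_reflect (h : R -> R) (M L : R) : measurable_fun setT h ->
  (forall x, 0 <= h x) -> (forall x, h x <= M) ->
  mean_log (fun x => h x * h (2 * pi - x)) L -> mean_log h (L / 2).
Proof.
move=> mh h0 hM [_ _ zf If eL].
pose h' x := h (2 * pi - x).
have mr : measurable_fun setT (fun x : R => 2 * pi - x) by exact: measurable_funB.
have mh' : measurable_fun setT h' by exact: measurableT_comp mh mr.
pose N : set (measurableTypeR R) := I2pi `&` (h \* h') @^-1` [set 0].
have mI : measurable (I2pi : set (measurableTypeR R)) by exact: measurable_itv.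
have mz (g : R -> R) : measurable_fun setT g -> measurable (I2pi `&` g @^-1` [set 0]).
  by move=> mg; apply: measurableI => //; rewrite -[X in measurable X]setTI; exact: mg.
have mN : measurable N by apply: mz; exact: measurable_funM.
have N0 : mu N = 0%E by exact: zf.
have mln (g : R -> R) : measurable_fun setT g -> measurable_fun setT (fun x => (ln (g x))%:E).
  by move=> mg; apply/measurable_EFinP; apply: measurableT_comp mg; exact: measurable_ln.
have pos x : (I2pi `\` N) x -> 0 < h x /\ 0 < h' x.
  move=> [Ix nx]; split; rewrite lt_neqAle h0 andbT eq_sym;
    by apply: contra_notN nx => /eqP hx; split => //=; rewrite hx ?mul0r ?mulr0.
(* The upper bound on the reflected factor gives a lower bound on the other: ln h = ln (h h') - ln
   h' >= ln (h h') - ln M. *)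
have bd (x : R) : (I2pi `\` N) x -> `|ln (h x)| <= `|ln (h x * h' x)| + `|ln M|.
  move=> /pos [p p'].
  have lM (y : R) : 0 < y -> y <= M -> ln y <= ln M.
    by move=> y0 yM; rewrite ler_ln ?posrE// (lt_le_trans y0).
  rewrite lnM ?posrE//.
  have l1 := lM _ p (hM _); have l2 := lM _ p' (hM _).
  have := ler_norm (ln M); have := ler_norm (- (ln (h x) + ln (h' x))); rewrite normrN.
  have := normr_ge0 (ln (h x) + ln (h' x)); have := normr_ge0 (ln M).
  by move=> b1 b2 b3 b4; rewrite ler_norml; lra.
have mD : measurable (I2pi `\` N) by exact: measurableD.
have ic : mu.-integrable I2pi (fun=> (`|ln M|)%:E).
  apply: (measurable_bounded_integrable (f := cst `|ln M|)) => //; first exact: mu_I2pi_fin.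
  by exists `|ln M|; split; rewrite ?num_real// => y cy x _ /=; rewrite normr_id; exact: ltW.
have ih : mu.-integrable I2pi (fun x => (ln (h x))%:E).
  rewrite (negligible_integrable mN)//; last exact: measurable_funTS (mln _ mh).
  have iB : mu.-integrable (I2pi `\` N) (fun x => ((`|ln (h x * h' x)|)%:E + (`|ln M|)%:E)%E).
    by apply: integrableS (integrableD mI (integrable_norm If) ic).
  apply: le_integrable iB => //; first exact: measurable_funTS (mln _ mh).
  by move=> x Dx; rewrite lee_fin/= (le_trans (bd x Dx))// ler_norm.
have ih' : mu.-integrable I2pi (fun x => (ln (h' x))%:E).
  apply/integrableP; split; first exact: measurable_funTS (mln _ mh').
  rewrite (integral_reflect (f := fun x => `|(ln (h x))%:E|%E)).
    by case/integrableP : ih.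
  exact: measurableT_comp (mln _ mh).
have e : (\int[mu]_(x in I2pi) (ln (h x))%:E + \int[mu]_(x in I2pi) (ln (h x))%:E = L%:E)%E.
  rewrite -[X in (_ + X)%E](integral_reflect (mln _ mh)) -integralD// -eL.
  rewrite [LHS](negligible_integral mN)//; last exact: integrableD.
  rewrite [RHS](negligible_integral mN)//.
  by apply: eq_integral => x /[!inE] /pos [p p']; rewrite -EFinD lnM ?posrE.
split => //.
- apply: (@subset_measure0 _ _ _ mu _ N) => //; first exact: mz.
  by move=> x [Ix hx]; split => //=; rewrite hx mul0r.
- have fi := integrable_fin_num mI ih; rewrite -(fineK fi) -EFinD in e.
  by case: e => <-; rewrite -[LHS](fineK fi); congr EFin; lra.
Qed.

Lemma cos_half (t : R) : cos t = 2 * cos (t / 2) ^+ 2 - 1.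
Proof.
have {1}-> : t = (t / 2) *+ 2 by rewrite -mulr_natr divfK.
by rewrite cos_mulr2n; ring.
Qed.

Lemma sin_half (t : R) : sin t = 2 * sin (t / 2) * cos (t / 2).
Proof.
have {1}-> : t = (t / 2) *+ 2 by rewrite -mulr_natr divfK.
by rewrite sin_mulr2n; ring.
Qed.

Lemma SP_sqr (k v : R) : 3 < k -> 0 <= v <= 4 -> SP k v ^+ 2 = k * SP k v + v.
Proof.
move=> k3 v04; have [_ nn _ _ _] := SP_facts k3 v04.
rewrite /SP; set n := Num.sqrt _ in nn *.
have -> : v = (n ^+ 2 - k ^+ 2) / 4 by rewrite nn; lra.
by field.
Qed.

(* |P_k|^2 at (e^(ia), e^(ib)), where b = psi + a / 2 - pi / 2. *)
Definition normP (k a psi : R) : R :=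
  ((1 + 2 * cos a) * (2 * sin psi) + 2 * k * cos (a / 2)) ^+ 2.

Lemma normP_le (k a psi : R) : normP k a psi <= (6 + 2 * `|k|) ^+ 2.
Proof.
rewrite /normP -ler_sqrt ?sqr_ge0// !sqrtr_sqr [leRHS]ger0_norm; last by rewrite addr_ge0// mulr_ge0.
apply: le_trans (ler_normD _ _) _; apply: lerD.
  rewrite normrM [leRHS](_ : _ = 3 * 2); last by lra.
  apply: ler_pM => //.
    by have := cos_geN1 a; have := cos_le1 a; rewrite ler_norml; lra.
  by have := sin_geN1 psi; have := sin_le1 psi; rewrite ler_norml; lra.
rewrite 2!normrM normr_nat -[leRHS]mulr1; apply: ler_pM => //; exact: cos_max.
Qed.

(** Writing q = 2 + 2 cos d, the function is 4 (cos a - cos d)^2 = |1 - e^(i(a+d))|^2 |1 -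
    e^(i(a-d))|^2: both roots are on the unit circle. *)
Lemma mean_log_sqrdiff (q : R) : 0 <= q <= 1 ->
  mean_log (fun a => ((2 + 2 * cos a) - q) ^+ 2) 0.
Proof.
move=> /andP[q0 q1].
have qd : -1 <= (q - 2) / 2 <= 1 by lra.
pose d := acos ((q - 2) / 2).
have cd : cos d = (q - 2) / 2 by rewrite acosK// in_itv.
have one : `|1 : R| <= 1 by rewrite normr1.
have := mean_logM (mean_log_shift d (circ2_periodic 1) (mean_log_circ2 one))
  (mean_log_shift (- d) (circ2_periodic 1) (mean_log_circ2 one)).
rewrite addr0; apply: eq_mean_log => a.
have -> : q = 2 + 2 * cos d by rewrite cd; lra.
rewrite /= /circ2 cosB cosD.
transitivity (4 * ((1 - cos a * cos d) ^+ 2 - sin a ^+ 2 * sin d ^+ 2)); first by rewrite /=; ring.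
by rewrite !sin2cos2; ring.
Qed.

(** Reflection changes the sign of cos (a / 2), so with u = 2 + 2 cos a the product is the square of
    v (u - 1)^2 - k^2 u. Because |k| = S - v / S, this quadratic is - (S^2 - v u) (u - v / S^2). The
    first factor is |X - Y e^(ia)|^2 with X Y = v and X + Y = S; the second has its root in [0, 1]
    and contributes nothing. The coefficient 4 pi combines the length of the circle with the squared
    modulus. *)
Lemma mean_log_normP (k psi : R) : 3 < `|k| ->
  mean_log (fun a => normP k a psi) (4 * pi * ln (XP `|k| (4 * sin psi ^+ 2))).
Proof.
move=> k3; have v04 := sin2_04 psi; set v := 4 * _ in v04 *.
have [p nn /andP[S1 S2] Sn qq] := SP_facts k3 v04.
have S2E := SP_sqr k3 v04.
have /andP[x0 _] := XP_bounds k3 v04.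
have r0 : 0 <= Num.sqrt (SP `|k| v ^+ 2 - 4 * v) by exact: sqrtr_ge0.
have rr : Num.sqrt (SP `|k| v ^+ 2 - 4 * v) ^+ 2 = SP `|k| v ^+ 2 - 4 * v.
  by rewrite sqr_sqrtr//; apply: le_trans qq; lra.
have rS : Num.sqrt (SP `|k| v ^+ 2 - 4 * v) <= SP `|k| v by apply: sqrt_le; move: v04; lra.
move: x0 r0 rr rS; rewrite /XP; set S := SP _ _ in S1 S2 S2E *; set r := Num.sqrt _ => x0 r0 rr rS.
have v0 : 0 <= v by case/andP : v04.
have v4 : v <= 4 by case/andP : v04.
pose X := (S + r) / 2; pose Y := (S - r) / 2.
have X0 : 0 < X by rewrite /X; lra.
have XY : X * Y = v by rewrite /X /Y (_ : _ * _ = (S ^+ 2 - r ^+ 2) / 4); [rewrite rr; lra|field].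
have XY2 : X ^+ 2 + Y ^+ 2 = S ^+ 2 - 2 * v.
  by rewrite /X /Y (_ : _ + _ = (S ^+ 2 + r ^+ 2) / 2); [rewrite rr; lra|field].
have rho : `|Y / X| <= 1.
  by rewrite ger0_norm ?divr_ge0 ?ler_pdivrMr ?mul1r ?/X ?/Y; lra.
have S0 : 0 < S by lra.
have q01 : 0 <= v / S ^+ 2 <= 1.
  have S20 : 0 < S ^+ 2 by rewrite exprn_gt0.
  apply/andP; split; first by rewrite divr_ge0// ltW.
  rewrite ler_pdivrMr// mul1r S2E lerDr mulr_ge0//; lra.
have X4 : 0 < X ^+ 4 by rewrite exprn_gt0.
have mc := mean_log_circ2 rho.
have := mean_logM (mean_log_cst X4) (mean_logM (mean_logM mc mc) (mean_log_sqrdiff q01)).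
rewrite !addr0 lnXn// => HL.
have -> : 4 * pi * ln X = 2 * pi * (ln X *+ 4) / 2 by rewrite -mulr_natr; lra.
apply: (@mean_log_reflect _ ((6 + 2 * `|k|) ^+ 2)).
- apply: measurable_funX; apply: measurable_funD.
  + apply: measurable_funM => //; apply: measurable_funD => //.
    by apply: measurable_funM => //; exact: measurable_cos.
  + apply: measurable_funM => //; apply: measurableT_comp; first exact: measurable_cos.
    exact: measurable_funM.
- by move=> x; exact: sqr_ge0.
- by move=> a; exact: normP_le.
- apply: eq_mean_log HL => a /=.
  have e2 : cos ((2 * pi - a) / 2) = - cos (a / 2).
    by rewrite (_ : (2 * pi - a) / 2 = - (a / 2) + pi) ?cosDpi ?cosN//; field.
  have ea : cos (2 * pi - a) = cos a.
    by rewrite addrC cos_periodic cosN.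
  have ca := cos_half a.
  rewrite /normP e2 ea.
  have -> : X ^+ 4 * (circ2 (Y / X) a * circ2 (Y / X) a * (2 + 2 * cos a - v / S ^+ 2) ^+ 2) =
    ((X ^+ 2 * circ2 (Y / X) a) * (2 + 2 * cos a - v / S ^+ 2)) ^+ 2 by ring.
  have -> : X ^+ 2 * circ2 (Y / X) a = S ^+ 2 - v * (2 + 2 * cos a).
    transitivity (X ^+ 2 + Y ^+ 2 - 2 * (X * Y) * cos a).
      by rewrite /circ2; field; exact: lt0r_neq0.
    by rewrite XY2 XY; ring.
  rewrite -exprMn.
  have -> : ((1 + 2 * cos a) * (2 * sin psi) + 2 * k * cos (a / 2)) *
    ((1 + 2 * cos a) * (2 * sin psi) + 2 * k * - cos (a / 2)) =
    (1 + 2 * cos a) ^+ 2 * v - `|k| ^+ 2 * (4 * cos (a / 2) ^+ 2).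
    by rewrite real_normK ?num_real// /v; ring.
  have -> : 4 * cos (a / 2) ^+ 2 = 2 + 2 * cos a by rewrite ca; ring.
  rewrite -[RHS]sqrrN; congr (_ ^+ 2).
  have -> : `|k| ^+ 2 = S ^+ 2 + v ^+ 2 / S ^+ 2 - 2 * v.
    have kE : `|k| = S - v / S.
      apply: (mulIf (lt0r_neq0 S0)); rewrite mulrBl divfK ?lt0r_neq0// -expr2 S2E; ring.
    by rewrite kE; field; exact: lt0r_neq0.
  by field; exact: lt0r_neq0.
Qed.

(* |R_k|^2 at (e^(ia), e^(ib)), where b = a + tau. *)
Definition normR (k a tau : R) : R :=
  let A := 2 * cos (3 * tau / 2) in let B := 2 * cos (tau / 2) in
  (k + (A - B) * cos (a + tau / 2)) ^+ 2 + ((A + B) * sin (a + tau / 2)) ^+ 2.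

Lemma normR_le (k a tau : R) : normR k a tau <= (`|k| + 4) ^+ 2 + 16.
Proof.
have c (x : R) : - 2 <= 2 * cos x <= 2 by have := cos_geN1 x; have := cos_le1 x; lra.
have := c (3 * tau / 2); have := c (tau / 2); rewrite /normR.
move: (2 * cos _) (2 * cos _) => B A hB hA.
have sq (x y : R) : `|x| <= y -> x ^+ 2 <= y ^+ 2.
  by move=> xy; rewrite -real_normK ?num_real// lerXn2r ?nnegrE// (le_trans _ xy).
apply: lerD.
  apply: sq; apply: le_trans (ler_normD _ _) _; rewrite lerD2l normrM -[leRHS]mulr1.
  by apply: ler_pM => //; [rewrite ler_norml; lra|exact: cos_max].
rewrite (_ : 16 = (4 * 1) ^+ 2); last by ring.
by apply: sq; rewrite normrM; apply: ler_pM => //; [rewrite ler_norml; lra|exact: sin_max].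
Qed.

(** The difference 256 - 27 w (4 - w)^2 has a double root at the maximum w = 4 / 3 and its third
    root at 16 / 3. *)
Lemma cubic_max (w : R) : w <= 16 / 3 -> w * (4 - w) ^+ 2 <= 256 / 27.
Proof.
move=> h; have : 0 <= (3 * w - 4) ^+ 2 * (16 - 3 * w).
  by rewrite mulr_ge0 ?sqr_ge0//; lra.
by lra.
Qed.

(** For z on the unit circle with real part c, the right-hand side is |k + A z - B / z|^2 with k =
    eps (X - A B / X), and A z^2 + k z - B = (A z + eps X) (z - eps B / X). *)
Lemma normR_factor (X A B eps c : R) : X != 0 -> eps = 1 \/ eps = - 1 ->
  X ^+ 2 * ((1 - 2 * (- eps * A / X) * c + (- eps * A / X) ^+ 2) *
            (1 - 2 * (eps * B / X) * c + (eps * B / X) ^+ 2)) =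
  (eps * (X - A * B / X) + (A - B) * c) ^+ 2 + (A + B) ^+ 2 * (1 - c ^+ 2).
Proof. by move=> X0 [] ->; field. Qed.

Lemma mean_log_normR (k tau : R) : 256 / 27 <= k ^+ 2 ->
  mean_log (fun a => normR k a tau) (4 * pi * ln (XR `|k| (2 + 2 * cos tau))).
Proof.
move=> kk.
have kE : k ^+ 2 = `|k| ^+ 2 by rewrite real_normK ?num_real.
have k3 : 3 < `|k| by rewrite -(@ltr_pXn2r _ 2) ?nnegrE// -kE; lra.
pose A := 2 * cos (3 * tau / 2); pose B := 2 * cos (tau / 2).
pose w := 2 + 2 * cos tau.
have w04 := cos2_04 tau; rewrite -/w in w04 *.
have ct := cos_half tau.
have wB : w = B ^+ 2 by rewrite /w /B ct; ring.
have AB : A = B * (w - 3).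
  rewrite wB /A /B (_ : 3 * tau / 2 = tau + tau / 2); last by field.
  rewrite cosD sin_half ct; have := sin2cos2 (tau / 2).
  move: (cos (tau / 2)) (sin (tau / 2)) => c s s2.
  transitivity (2 * ((2 * c ^+ 2 - 1) * c - 2 * c * s ^+ 2)); first by ring.
  by rewrite s2; ring.
have dAB : (A - B) ^+ 2 <= `|k| ^+ 2.
  have h : w * (4 - w) ^+ 2 <= 256 / 27 by apply: cubic_max; lra.
  rewrite -kE; apply: le_trans kk; apply: le_trans h.
  have -> // : (A - B) ^+ 2 = w * (4 - w) ^+ 2.
  by rewrite AB [X in _ = X * _]wB; ring.
have {}dAB : - `|k| <= A - B <= `|k|.
  by have := sqrt_le (normr_ge0 k) dAB; rewrite sqrtr_sqr -ler_norml.
have X0 : 0 < XR `|k| w by have /andP[+ _] := XR_bounds k3 w04; lra.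
have q := XR_pos w k3.
have D0 : 0 <= `|k| ^+ 2 + 4 * (w * (w - 3)) by apply: le_trans q; exact: sqr_ge0.
have rr := sqr_sqrtr D0.
have ABw : A * B = w * (w - 3) by rewrite AB wB; ring.
have XE : XR `|k| w ^+ 2 = `|k| * XR `|k| w + A * B.
  by rewrite ABw /XR; set r := Num.sqrt _ in rr *; rewrite (_ : w * (w - 3) = (r ^+ 2 - `|k| ^+ 2) / 4); [field|rewrite rr; lra].
have r0 := sqrtr_ge0 (`|k| ^+ 2 + 4 * (w * (w - 3))).
(* Squared, the claim is (2 |C| - |k|)^2 <= k^2 + 4 C C'. For C >= 0 it reduces to C (C - C' - |k|)
   <= 0, and the case C < 0 is symmetric. It serves for (A, B) and (B, A), placing both root moduli
   [|A| / X] and [|B| / X] in [0, 1]. *)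
have XA C C' : C * C' = w * (w - 3) -> - `|k| <= C - C' <= `|k| -> `|C| <= XR `|k| w.
  move=> CC' /andP[h1 h2]; rewrite /XR ler_pdivlMr//.
  have : 2 * `|C| - `|k| <= Num.sqrt (`|k| ^+ 2 + 4 * (w * (w - 3))).
    apply: sqrt_ge; rewrite -CC'.
    have [C0|C0] := leP 0 C.
      have h : 0 <= C * (`|k| - (C - C')) by rewrite mulr_ge0//; lra.
      by rewrite ger0_norm//; lra.
    have h : 0 <= - C * (`|k| + (C - C')) by rewrite mulr_ge0//; lra.
    by rewrite ltr0_norm//; lra.
  by lra.
have [eps e1 ek] : exists2 eps : R, eps = 1 \/ eps = - 1 & k = eps * `|k|.
  have [k0|k0] := leP 0 k; first by exists 1; [left|rewrite ger0_norm// mul1r].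
  by exists (- 1); [right|rewrite ltr0_norm// mulN1r opprK].
have ne : `|eps| = 1 by case: e1 => ->; rewrite ?normrN normr1.
set X := XR _ _ in X0 XE XA *.
have c1 : `|- eps * A / X| <= 1.
  by rewrite 2!normrM normrN ne mul1r normfV (gtr0_norm X0) ler_pdivrMr// mul1r; exact: XA ABw dAB.
have c2 : `|eps * B / X| <= 1.
  rewrite 2!normrM ne mul1r normfV (gtr0_norm X0) ler_pdivrMr// mul1r; apply: (XA B A); lra.
have X2 : 0 < X ^+ 2 by rewrite exprn_gt0.
have := mean_logM (mean_log_cst X2) (mean_logM
  (mean_log_shift (tau / 2) (circ2_periodic _) (mean_log_circ2 c1))
  (mean_log_shift (tau / 2) (circ2_periodic _) (mean_log_circ2 c2))).
rewrite !addr0 lnXn// (_ : 2 * pi * (ln X *+ 2) = 4 * pi * ln X); last by rewrite -mulr_natr; ring.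
apply: eq_mean_log => a; rewrite /normR -/A -/B.
have kX : `|k| = X - A * B / X.
  by apply: (mulIf (lt0r_neq0 X0)); rewrite mulrBl divfK ?lt0r_neq0// -expr2 XE; ring.
rewrite {1}ek kX [RHS](_ : _ = (eps * (X - A * B / X) + (A - B) * cos (a + tau / 2)) ^+ 2 +
  (A + B) ^+ 2 * (1 - cos (a + tau / 2) ^+ 2)); last by rewrite -sin2cos2 exprMn.
by rewrite -normR_factor//; exact: lt0r_neq0.
Qed.

End Jensen.

(** * The two polynomials in angular coordinates on the torus *)

Section Circ.
Set Implicit Arguments.
Unset Strict Implicit.
Context {R : realType}.
Implicit Types a b t k : R.

Lemma circD a b : circ (a + b) = circ a * circ b.
Proof.
by rewrite /circ cosD sinD; apply/eqP; rewrite eq_complex/= eqxx/=; apply/eqP; ring.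
Qed.

Lemma circ0 : circ 0 = 1 :> R[i].
Proof. by rewrite /circ cos0 sin0. Qed.

Lemma normc_circ a : Normc.normc (circ a) = 1.
Proof. by rewrite /= cos2Dsin2 sqrtr1. Qed.

Lemma circ_periodic a : circ (a + 2 * pi) = circ a.
Proof. by rewrite /circ cos_periodic mulrC mulr_natr sinD2pi. Qed.

Lemma circDN a : circ a + circ (- a) = Complex (2 * cos a) 0.
Proof. by rewrite /circ cosN sinN; apply/eqP; rewrite eq_complex/= subrr eqxx andbT; apply/eqP; ring. Qed.

Lemma ln_sqrt (x : R) : 0 <= x -> ln (Num.sqrt x) = ln x / 2.
Proof.
rewrite le_eqVlt => /predU1P[<-|x0]; first by rewrite sqrtr0 ln0// mul0r.
have s0 : 0 < Num.sqrt x by rewrite sqrtr_gt0.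
have -> : ln x = ln (Num.sqrt x) *+ 2 by rewrite -lnXn// sqr_sqrtr// ltW.
by rewrite mulr2n; lra.
Qed.

(** P_k is self-reciprocal: x^3 y^2 P_k(1/x, 1/y) = P_k(x, y). Hence division by x^(3/2) y, read as
    a function of the angles, leaves a real number. *)
Lemma P_k_circ k a b :
  P_k k (circ a) (circ b) = circ (2 * a) * circ (b - a / 2) *
    Complex ((1 + 2 * cos a) * (2 * cos (b - a / 2)) + 2 * k * cos (a / 2)) 0.
Proof.
pose u := circ (a / 2); pose z := circ (b - a / 2).
have ui : u * circ (- (a / 2)) = 1 by rewrite -circD subrr circ0.
have zi : z * circ (- (b - a / 2)) = 1 by rewrite -circD subrr circ0.
have xu : circ a = u ^+ 2 by rewrite expr2 -circD; congr circ; lra.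
have yu : circ b = u * z by rewrite -circD; congr circ; lra.
have x2 : circ (2 * a) = u ^+ 4 by rewrite (_ : 2 * a = a + a) ?circD ?xu; [ring|lra].
have -> : Complex ((1 + 2 * cos a) * (2 * cos (b - a / 2)) + 2 * k * cos (a / 2)) 0 =
  (1 + Complex (2 * cos a) 0) * Complex (2 * cos (b - a / 2)) 0 + (k%:C)%C * Complex (2 * cos (a / 2)) 0.
  by apply/eqP; rewrite eq_complex/=; apply/andP; split; apply/eqP; ring.
rewrite -!circDN xu -/u -/z x2.
have -> : circ (- a) = circ (- (a / 2)) ^+ 2 by rewrite expr2 -circD; congr circ; lra.
rewrite /P_k yu; move: ui zi; move: (circ (- (a / 2))) (circ (- (b - a / 2))) => ui zi uu zz.
clear xu yu x2; clearbody u z.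
(* Padding with [u * ui] and [z * zi], both equal to 1, makes the two sides agree as polynomials. *)
transitivity (u ^+ 2 * (u ^+ 4 + u ^+ 2 + u * ui * (u * ui)) * z ^+ 2 +
  (k%:C)%C * u ^+ 3 * (u ^+ 2 + u * ui) * z +
  u ^+ 2 * (u ^+ 4 + u ^+ 2 + (u * ui) ^+ 2) * (z * zi)).
  by rewrite uu zz; ring.
ring.
Qed.

(** With u = e^(i(a+b)/2) and p = e^(i(b-a)/2), R_k / (x y) = k + (p^3 + p^(-3)) u - (p + p^(-1)) /
    u. The coefficients of u and 1 / u are real and depend on b - a alone, which dictates the
    shear. *)
Lemma R_k_circ k a b : let t := b - a in
  R_k k (circ a) (circ b) = circ (a + b) *
    Complex (k + (2 * cos (3 * t / 2) - 2 * cos (t / 2)) * cos (a + t / 2))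
            ((2 * cos (3 * t / 2) + 2 * cos (t / 2)) * sin (a + t / 2)).
Proof.
move=> t.
pose u := circ (a + t / 2); pose p := circ (t / 2).
pose u' := circ (- (a + t / 2)); pose p' := circ (- (t / 2)).
have uu : u * u' = 1 by rewrite -circD subrr circ0.
have pp : p * p' = 1 by rewrite -circD subrr circ0.
have xE : circ a = u * p' by rewrite -circD; congr circ; rewrite /t; lra.
have yE : circ b = u * p by rewrite -circD; congr circ; rewrite /t; lra.
have abE : circ (a + b) = u ^+ 2 by rewrite expr2 -circD; congr circ; rewrite /t; lra.
have -> : Complex (k + (2 * cos (3 * t / 2) - 2 * cos (t / 2)) * cos (a + t / 2))
            ((2 * cos (3 * t / 2) + 2 * cos (t / 2)) * sin (a + t / 2)) =
  (k%:C)%C + Complex (2 * cos (3 * t / 2)) 0 * u - Complex (2 * cos (t / 2)) 0 * u'.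
  by rewrite /u /u' /circ cosN sinN; apply/eqP; rewrite eq_complex/=; apply/andP; split; apply/eqP; ring.
rewrite -!circDN -/p -/p' abE.
have -> : circ (3 * t / 2) = p ^+ 3 by rewrite !exprS expr0 mulr1 -!circD; congr circ; lra.
have -> : circ (- (3 * t / 2)) = p' ^+ 3 by rewrite !exprS expr0 mulr1 -!circD; congr circ; lra.
rewrite /R_k xE yE; clear xE yE abE; clearbody u p u' p'.
transitivity (u ^+ 3 * p ^+ 3 - u * p * (u * u') + u ^+ 3 * p' ^+ 3 - u * p' * (u * u') +
  (k%:C)%C * u ^+ 2 * (p * p')).
  by rewrite uu; ring.
by rewrite pp; ring.
Qed.

Lemma ln_normP k a b :
  ln (Normc.normc (P_k k (circ a) (circ b))) = ln (normP k a (b - a / 2 + pi / 2)) / 2.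
Proof.
rewrite P_k_circ !Normc.normcM !normc_circ !mul1r /= expr0n addr0 ln_sqrt ?sqr_ge0//.
by rewrite /normP sinDpihalf.
Qed.

Lemma ln_normR k a b :
  ln (Normc.normc (R_k k (circ a) (circ b))) = ln (normR k a (b - a)) / 2.
Proof.
by rewrite R_k_circ Normc.normcM normc_circ mul1r ln_sqrt// addr_ge0// sqr_ge0.
Qed.

End Circ.

(** * The Mahler measures as one-variable integrals *)

Section Mahler.
Set Implicit Arguments.
Unset Strict Implicit.
Context {R : realType}.
Notation mu := (@lebesgue_measure R).
Notation I2pi := (`[0%R, (2 * pi)%R]%classic : set R).
Notation RT := (measurableTypeR R).
Notation RR := (measurableTypeR R * measurableTypeR R)%type.

Lemma mean_log_half (f : R -> R) L : mean_log f L ->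
  mu.-integrable I2pi (fun a => (ln (f a) / 2)%:E) /\
  (\int[mu]_(a in I2pi) (ln (f a) / 2)%:E = (L / 2)%:E)%E.
Proof.
move=> [_ _ _ If eL]; have mI : measurable (I2pi : set RT) by exact: measurable_itv.
have e a : (ln (f a) / 2)%:E = ((2^-1)%:E * (ln (f a))%:E)%E by rewrite -EFinM mulrC.
split.
  by have := integrableZl mI 2^-1 If; apply: eq_integrable => // a _; exact/esym/e.
under eq_integral do rewrite e.
by rewrite integralZl// eL -EFinM mulrC.
Qed.

Lemma mahler_shear (F : R[i] -> R[i] -> R[i]) (f : R -> R -> R) (sigma X : R -> R) (C : R) :
  (forall a b, ln (Normc.normc (F (circ a) (circ b))) = ln (f a (b - sigma a)) / 2) ->
  measurable_fun (setT : set RR) (fun z : RR => f z.1 (z.2 - sigma z.1)) ->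
  measurable_fun setT sigma ->
  (forall a b, 0 <= f a b) -> 1 <= C -> (forall a b, f a b <= C) ->
  (forall b, mean_log (f ^~ b) (4 * pi * ln (X b))) ->
  continuous (fun b => ln (X b)) ->
  mahler F = (((2 * pi) ^+ 2)^-1 * (2 * pi * \int[mu]_(b in I2pi) ln (X b)))%:E.
Proof.
move=> FE mf ms f0 C1 fC fX cX; rewrite /mahler EFinM; congr (_ * _)%E.
pose G a b := ln (Normc.normc (F (circ a) (circ b))).
have mI : measurable (I2pi : set RT) by exact: measurable_itv.
have iX := continuous_integrable_I2pi cX.
apply: (@integral_torus_shear R G (ln C / 2) sigma (fun b => 2 * pi * ln (X b))) => //.
- rewrite /G; under eq_fun do rewrite FE.
  apply: measurable_funM => //; apply: measurableT_comp mf; exact: measurable_ln.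
- move=> a b; rewrite /G FE ler_wpM2r//.
  (* At a zero of the polynomial [ln] takes the value 0, which is below [ln C] because [1 <= C]. *)
  have := f0 a (b - sigma a); rewrite le_eqVlt => /predU1P[<-|h].
    by rewrite ln0// ln_ge0.
  by rewrite ler_ln ?posrE// (lt_le_trans ltr01).
- by move=> a b; rewrite /G circ_periodic.
- move=> b; have [h1 h2] := mean_log_half (fX b).
  have e a : G a (b + sigma a) = ln (f a b) / 2 by rewrite /G FE addrK.
  split; first by apply: eq_integrable h1 => // a _; congr EFin; exact/esym/e.
  transitivity (\int[mu]_(a in I2pi) (ln (f a b) / 2)%:E)%E.
    by apply: eq_integral => a _; congr EFin; exact: e.
  by rewrite h2; congr EFin; lra.
- have := integrableZl mI (2 * pi) iX; apply: eq_integrable => // b _.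
- have iXX : (\int[mu]_(b in I2pi) (ln (X b))%:E)%E \is a fin_num by exact: integrable_fin_num.
  under eq_integral do rewrite EFinM.
  by rewrite integralZl// -[X in (_ * X)%E = _](fineK iXX) -EFinM.
Qed.

Lemma measurable_cos_comp (f : RR -> R) : measurable_fun setT f ->
  measurable_fun setT (fun z => cos (f z)).
Proof. by move=> mf; apply: measurableT_comp mf; exact: measurable_cos. Qed.

Lemma measurable_sin_comp (f : RR -> R) : measurable_fun setT f ->
  measurable_fun setT (fun z => sin (f z)).
Proof.
move=> mf; apply: measurableT_comp mf; apply: continuous_measurable_fun.
exact: continuous_sin.
Qed.

Lemma mahler_P (k : R) : 3 < `|k| ->
  mahler (P_k k) = (((2 * pi) ^+ 2)^-1 * (2 * pi * jensenP `|k|))%:E.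
Proof.
move=> k3; apply: (@mahler_shear _ (normP k) (fun a => a / 2 - pi / 2)
  (fun b => XP `|k| (4 * sin b ^+ 2)) ((6 + 2 * `|k|) ^+ 2)).
- by move=> a b; rewrite ln_normP; congr (ln (normP _ _ _) / _); ring.
- rewrite /normP; apply: measurable_funX; apply: measurable_funD.
  + apply: measurable_funM.
      apply: measurable_funD => //; apply: measurable_funM => //.
      exact: measurable_cos_comp.
    apply: measurable_funM => //; apply: measurable_sin_comp.
    apply: measurable_funB => //; apply: measurable_funB => //.
    exact: measurable_funM.
  + apply: measurable_funM => //; apply: measurable_cos_comp.
    exact: measurable_funM.
- by apply: measurable_funB => //; exact: measurable_funM.
- by move=> a b; exact: sqr_ge0.
- by rewrite -[leLHS](expr1n _ 2) lerXn2r ?nnegrE//; lra.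
- by move=> a b; exact: normP_le.
- by move=> b; exact: mean_log_normP.
- exact: continuous_lnXP.
Qed.

Lemma mahler_R (k : R) : 256 / 27 <= k ^+ 2 ->
  mahler (R_k k) = (((2 * pi) ^+ 2)^-1 * (2 * pi * jensenR `|k|))%:E.
Proof.
move=> kk.
have k3 : 3 < `|k| by rewrite -(@ltr_pXn2r _ 2) ?nnegrE// real_normK ?num_real//; lra.
apply: (@mahler_shear _ (normR k) (fun a => a)
  (fun b => XR `|k| (2 + 2 * cos b)) ((`|k| + 4) ^+ 2 + 16)).
- by move=> a b; rewrite ln_normR.
- have m1 : measurable_fun (setT : set RR) (fun z : RR => z.2 - z.1).
    exact: measurable_funB.
  have m2 : measurable_fun (setT : set RR) (fun z : RR => 2 * cos (3 * (z.2 - z.1) / 2)).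
    apply: measurable_funM => //; apply: measurable_cos_comp.
    by apply: measurable_funM => //; exact: measurable_funM.
  have m3 : measurable_fun (setT : set RR) (fun z : RR => 2 * cos ((z.2 - z.1) / 2)).
    apply: measurable_funM => //; apply: measurable_cos_comp.
    exact: measurable_funM.
  have m4 : measurable_fun (setT : set RR) (fun z : RR => z.1 + (z.2 - z.1) / 2).
    by apply: measurable_funD => //; exact: measurable_funM.
  rewrite /normR; apply: measurable_funD; apply: measurable_funX.
    apply: measurable_funD => //; apply: measurable_funM; first exact: measurable_funB.
    exact: measurable_cos_comp.
  apply: measurable_funM; first exact: measurable_funD.
  exact: measurable_sin_comp.
- by [].
- by move=> a b; rewrite addr_ge0// sqr_ge0.
- by have := sqr_ge0 (`|k| + 4); lra.
- by move=> a b; exact: normR_le.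
- by move=> b; exact: mean_log_normR.
- exact: continuous_lnXR.
Qed.

End Mahler.

Theorem theorem2 (R : realType) (k : R) :
  16 / (3 * Num.sqrt 3) <= `|k| -> mahler (P_k k) = mahler (R_k k).
Proof.
move=> hk.
have kk : 256 / 27 <= k ^+ 2.
  have s0 : 0 < Num.sqrt 3 :> R by rewrite sqrtr_gt0.
  have s3 : Num.sqrt 3 ^+ 2 = 3 :> R by rewrite sqr_sqrtr.
  rewrite -[leRHS]real_normK ?num_real//.
  have -> : 256 / 27 = (16 / (3 * Num.sqrt 3)) ^+ 2 :> R.
    rewrite (_ : (16 / (3 * Num.sqrt 3)) ^+ 2 = 256 / (9 * Num.sqrt 3 ^+ 2)).
      by rewrite s3; lra.
    by field; exact: lt0r_neq0.
  by rewrite lerXn2r ?nnegrE// divr_ge0// mulr_ge0// ltW.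
(* Indeed 256 / 27 > 9, so the hypothesis lies inside the range K > 3 of the comparison of the two
   integrals. *)
have k3 : 3 < `|k| by rewrite -(@ltr_pXn2r _ 2) ?nnegrE// real_normK ?num_real//; lra.
by rewrite mahler_P// mahler_R// jensenP_eq_jensenR.
Qed.
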